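(* Assume $\mathfrak p<\mathfrak t$ and let $\lambda=\mathfrak p$. Then there is a regular cardinal $\kappa$ with $\aleph_1\le\kappa<\lambda$ such that a $(\kappa,\lambda)$-peculiar cut in ${}^\omega\omega$ exists.
   Context: $[\omega]^{\aleph_0}$ is the set of infinite subsets of $\omega$; $A\subseteq^*B$ means $A\setminus B$ is finite. $\mathfrak p$ is the least cardinality of a family $\mathcal B\subseteq[\omega]^{\aleph_0}$ all of whose finite subfamilies have infinite intersection but with no $A\in[\omega]^{\aleph_0}$ satisfying $A\subseteq^*B$ for all $B\in\mathcal B$; $\mathfrak t$ is the least length of a $\subseteq^*$-decreasing sequence in $[\omega]^{\aleph_0}$ with no such $A$. For $f,g\in{}^\omega\omega$: $f\le^*g$ iff $f(n)\le g(n)$ for all but finitely many $n$; $f<^*g$ iff $f(n)<g(n)$ for all but finitely many $n$. For infinite regular cardinals $\kappa_1,\kappa_2$, a $(\kappa_1,\kappa_2)$-peculiar cut in ${}^\omega\omega$ is a pair $(\langle f_i:i<\kappa_1\rangle,\langle f^\alpha:\alpha<\kappa_2\rangle)$ of sequences in ${}^\omega\omega$ such that: ($\alpha$) $f_j<^*f_i$ for $i<j<\kappa_1$; ($\beta$) $f^\alpha<^*f^\beta$ for $\alpha<\beta<\kappa_2$; ($\gamma$) $f^\alpha<^*f_i$ for all $i<\kappa_1$, $\alpha<\kappa_2$; ($\delta$) if $f\in{}^\omega\omega$ and $f\le^*f_i$ for all $i<\kappa_1$, then $f\le^*f^\alpha$ for some $\alpha<\kappa_2$; ($\varepsilon$)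 if $f\in{}^\omega\omega$ and $f^\alpha\le^*f$ for all $\alpha<\kappa_2$, then $f_i\le^*f$ for some $i<\kappa_1$. *)

(* Defs.v *)
(* Cardinals are represented by types (cardinality via
   injections/bijections), ordinals by well-ordered types. *)
From Stdlib Require Import Arith List.
Import ListNotations.

Definition injective {A B : Type} (f : A -> B) : Prop :=
  forall x y, f x = f y -> x = y.

Definition le_card (A B : Type) : Prop := exists f : A -> B, injective f.
Definition lt_card (A B : Type) : Prop := le_card A B /\ ~ le_card B A.
Definition eq_card (A B : Type) : Prop :=
  exists (f : A -> B) (g : B -> A),
    (forall a, g (f a) = a) /\ (forall b, f (g b) = b).

Definition strict_well_order (W : Type) (R : W -> W -> Prop) : Prop :=
  (forall x, ~ R x x) /\
  (forall x y z, R x y -> R y z -> R x z) /\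
  (forall x y, R x y \/ x = y \/ R y x) /\
  well_founded R.

(* (W,R) is an infinite initial ordinal, i.e. an infinite cardinal *)
Definition is_infinite_cardinal (W : Type) (R : W -> W -> Prop) : Prop :=
  strict_well_order W R /\
  le_card nat W /\
  (forall x : W, lt_card {y : W | R y x} W).

Definition is_regular_cardinal (W : Type) (R : W -> W -> Prop) : Prop :=
  is_infinite_cardinal W R /\
  (forall S : W -> Prop,
      (forall x, exists y, S y /\ ~ R y x) -> le_card W {y : W | S y}).

Definition infinite_set (A : nat -> Prop) : Prop :=
  forall n, exists m, n <= m /\ A m.

Definition subq_star (A B : nat -> Prop) : Prop :=
  exists N, forall n, N <= n -> A n -> B n.

Definition p_family (B : (nat -> Prop) -> Prop) : Prop :=
  (forall A, B A -> infinite_set A) /\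
  (forall l : list (nat -> Prop),
      (forall A, In A l -> B A) ->
      infinite_set (fun n => forall A, In A l -> A n)) /\
  ~ (exists A, infinite_set A /\ forall C, B C -> subq_star A C).

Definition is_p (P : Type) : Prop :=
  (exists B, p_family B /\ eq_card {A | B A} P) /\
  (forall B, p_family B -> le_card P {A | B A}).

Definition tower (W : Type) (R : W -> W -> Prop) (s : W -> nat -> Prop) : Prop :=
  strict_well_order W R /\
  (forall a, infinite_set (s a)) /\
  (forall a b, R a b -> subq_star (s b) (s a)) /\
  ~ (exists A, infinite_set A /\ forall a, subq_star A (s a)).

(* p < t : every tower has length (as a well-order) of cardinality > p.
   (t is the least such length, which is a cardinal.) *)
Definition p_lt_t (P : Type) : Prop :=
  forall (W : Type) (R : W -> W -> Prop) (s : W -> nat -> Prop),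
    tower W R s -> lt_card P W.

Definition le_star (f g : nat -> nat) : Prop :=
  exists N, forall n, N <= n -> f n <= g n.
Definition lt_star (f g : nat -> nat) : Prop :=
  exists N, forall n, N <= n -> f n < g n.

(* (κ1,κ2)-peculiar cut, κ1 = (W1,R1), κ2 = (W2,R2) regular cardinals;
   lo i = f_i (i < κ1), up a = f^a (a < κ2) *)
Definition peculiar_cut (W1 : Type) (R1 : W1 -> W1 -> Prop)
    (W2 : Type) (R2 : W2 -> W2 -> Prop)
    (lo : W1 -> nat -> nat) (up : W2 -> nat -> nat) : Prop :=
  is_regular_cardinal W1 R1 /\ is_regular_cardinal W2 R2 /\
  (forall i j, R1 i j -> lt_star (lo j) (lo i)) /\
  (forall a b, R2 a b -> lt_star (up a) (up b)) /\
  (forall i a, lt_star (up a) (lo i)) /\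
  (forall f, (forall i, le_star f (lo i)) -> exists a, le_star f (up a)) /\
  (forall f, (forall a, le_star (up a) f) -> exists i, le_star (lo i) f).

(* Main.v *)
(* Let lambda = p. Starting from a family B of size lambda witnessing p, closed under finite
   intersections, build an almost-decreasing sequence of B-positive sets running through B. Since
   lambda < t, it must break down before lambda; the cofinality kappa of the failing stage gives an
   almost-decreasing chain (A_i : i < kappa) of B-positive sets without B-positive
   pseudo-intersection. Since lambda < b, there are intervals [n, G n] in which every A_i and B_l
   meet for almost all n. As kappa < p, on an infinite set of n one rank function turns all the
   traces A_i on [n, G n] into sublevel sets {rank < f_i(n)}; with h_l(n) the least rank of B_l, plus
   one, the families (f_i) and (h_l) cannot be separated on any infinite set of n. By recursion of
   length lambda, shrinking the domain at each step (any kappa + alpha < p requirements can be met on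
   an infinite set, and lambda < t gives a final domain), (h_l) is replaced by an increasing
   sequence of length lambda. Being unseparated on every infinite set yields regularity of lambda,
   uncountability of kappa and the two cut conditions. *)
From Stdlib Require Import Arith List Lia Relation_Operators Wellfounded.
From Stdlib Require Import Classical ClassicalEpsilon FunctionalExtensionality.
From Stdlib Require Import Cantor.
From Stdlib Require FinFun.
From mathcomp Require boolp wochoice.
Require Import Defs.
Import ListNotations.

(** * Well-founded recursion and cardinal arithmetic *)

Definition seg {W : Type} (R : W -> W -> Prop) (a : W) : Type := {b : W | R b a}.

Lemma wf_least {W} (R : W -> W -> Prop) (Q : W -> Prop) :
  well_founded R -> (exists x, Q x) -> exists x, Q x /\ forall y, R y x -> ~ Q y.
Proof.
  intros wf [x Hx]. revert Hx. induction (wf x) as [x _ IH]. intros Hx.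
  destruct (classic (exists y, R y x /\ Q y)) as [[y [Ryx Qy]] | H].
  - exact (IH y Ryx Qy).
  - exists x. split; [exact Hx|]. intros y Ry Qy. apply H. eauto.
Qed.

(** Choose an acceptable value by [epsilon] at every stage of a well-founded recursion. If this
    fails somewhere, the least failing stage has a correct history and no acceptable value. The
    second alternative drives all the breakdown arguments below. *)
Lemma wf_choice {W T} (R : W -> W -> Prop) (Ok : W -> (W -> T) -> T -> Prop) (t0 : T) :
  well_founded R ->
  (forall a s s' x, (forall b, R b a -> s b = s' b) -> Ok a s x -> Ok a s' x) ->
  (exists s, forall a, Ok a s (s a)) \/
  (exists a s, (forall b, R b a -> Ok b s (s b)) /\ forall x, ~ Ok a s x).
Proof.
  intros wf ext.
  (* The history below [a] becomes a total function with the default [t0] elsewhere; by [ext],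
     [Ok a] does not see the default. *)
  pose (ext_rec := fun (a : W) (rec : forall b, R b a -> T) (b : W) =>
     match excluded_middle_informative (R b a) with
     | left H => rec b H | right _ => t0 end).
  pose (F := fun a rec => epsilon (inhabits t0) (fun x => Ok a (ext_rec a rec) x)).
  pose (s := Fix wf (fun _ => T) F).
  assert (Hs : forall a, s a = F a (fun b _ => s b)).
  { intros a. unfold s. apply (Fix_eq wf (fun _ => T) F).
    intros x f g Hfg. unfold F. f_equal. apply functional_extensionality. intros y.
    f_equal. apply functional_extensionality. intros b. unfold ext_rec.
    destruct (excluded_middle_informative (R b x)); auto. }
  assert (Hok : forall a, (exists x, Ok a s x) -> Ok a s (s a)).
  { intros a [x Hx].
    assert (E : forall b, R b a -> ext_rec a (fun b _ => s b) b = s b).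
    { intros b Rb. unfold ext_rec. destruct (excluded_middle_informative (R b a)); tauto. }
    apply (ext a (ext_rec a (fun b _ => s b)) s _ E).
    rewrite Hs. unfold F. apply epsilon_spec. exists x.
    apply (ext a s); [|exact Hx]. intros b Rb. symmetry. auto. }
  destruct (classic (exists a, ~ Ok a s (s a))) as [H | H].
  - right. destruct (wf_least R _ wf H) as [a [Ha Hmin]]. exists a, s. split.
    + intros b Rb. apply NNPP. exact (Hmin b Rb).
    + intros x Hx. apply Ha. apply Hok. eauto.
  - left. exists s. intros a. apply NNPP. intros Ha. apply H. eauto.
Qed.

(** * Comparison of cardinalities and well-orderings *)

Lemma le_card_refl A : le_card A A.
Proof. exists (fun x => x). intros x y e. exact e. Qed.

Lemma le_card_trans A B C : le_card A B -> le_card B C -> le_card A C.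
Proof.
  intros [f Hf] [g Hg]. exists (fun x => g (f x)). intros x y e. apply Hf, Hg, e.
Qed.

Lemma le_card_surj {A B : Type} : le_card A B -> A ->
  exists g : B -> A, forall x, exists y, g y = x.
Proof.
  intros [f Hf] a0.
  exists (fun b => epsilon (inhabits a0) (fun a => f a = b)). intros x. exists (f x).
  apply Hf. apply (epsilon_spec (inhabits a0) (fun a => f a = f x)). eauto.
Qed.

Lemma surj_le_card {A B : Type} (g : B -> A) : (forall x, exists y, g y = x) -> le_card A B.
Proof.
  intros Hg. destruct (choice _ Hg) as [f Hf]. exists f.
  intros x y e. rewrite <- (Hf x), <- (Hf y), e. reflexivity.
Qed.

Lemma sig_ext {A} {Q : A -> Prop} (x y : {a | Q a}) : proj1_sig x = proj1_sig y -> x = y.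
Proof.
  destruct x as [x Hx], y as [y Hy]. simpl. intros ->. f_equal. apply proof_irrelevance.
Qed.

Lemma le_card_sig {A} (Q : A -> Prop) : le_card {a | Q a} A.
Proof. exists (@proj1_sig _ _). intros x y. apply sig_ext. Qed.

Lemma le_card_sig_incl {A} (Q Q' : A -> Prop) :
  (forall a, Q a -> Q' a) -> le_card {a | Q a} {a | Q' a}.
Proof.
  intros H. exists (fun x => exist Q' (proj1_sig x) (H _ (proj2_sig x))).
  intros x y e. apply sig_ext. exact (f_equal (@proj1_sig _ _) e).
Qed.

Lemma le_card_prod A B A' B' : le_card A A' -> le_card B B' -> le_card (A * B) (A' * B').
Proof.
  intros [f Hf] [g Hg]. exists (fun p => (f (fst p), g (snd p))).
  intros [a b] [a' b'] e. simpl in e. injection e as e1 e2.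
  f_equal; [apply Hf | apply Hg]; assumption.
Qed.

(** Pick pairwise distinct elements of [T] along [R]. Either this never stops and injects [W] into
    [T], or at some stage the values already chosen exhaust [T]. *)
Lemma card_dichotomy {W} (R : W -> W -> Prop) (T : Type) :
  strict_well_order W R -> le_card W T \/ exists w, le_card T (seg R w).
Proof.
  intros [irr [tr [tri wf]]].
  destruct (classic (inhabited T)) as [[t0] | HT].
  - destruct (wf_choice R (fun a s x => forall b, R b a -> s b <> x) t0 wf)
      as [[s Hs] | [a [s [_ Hs]]]].
    + intros a s s' x E H b Rb. rewrite <- (E b Rb). auto.
    + left. exists s. intros x y e. destruct (tri x y) as [H | [H | H]]; [|exact H|].
      * destruct (Hs y x H e).
      * destruct (Hs x y H (eq_sym e)).
    + right. exists a. apply (surj_le_card (fun b : seg R a => s (proj1_sig b))).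
      intros x. apply NNPP. intros H. apply (Hs x). intros b Rb e. apply H.
      exists (exist _ b Rb). exact e.
  - destruct (classic (inhabited W)) as [[w] | HW].
    + right. exists w. exists (fun t => False_rect _ (HT (inhabits t))).
      intros x. destruct (HT (inhabits x)).
    + left. exists (fun t => False_rect _ (HW (inhabits t))).
      intros x. destruct (HW (inhabits x)).
Qed.

Lemma swo_pullback {A B} (R : B -> B -> Prop) (f : A -> B) :
  injective f -> strict_well_order B R -> strict_well_order A (fun x y => R (f x) (f y)).
Proof.
  intros Hf [irr [tr [tri wf]]]. split; [|split; [|split]].
  - intros x. apply irr.
  - intros x y z. apply tr.
  - intros x y. destruct (tri (f x) (f y)) as [H | [H | H]]; auto.
  - apply wf_inverse_image. exact wf.
Qed.

(** The imported principle gives a boolean non-strict order. Least elements of sets with one, two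
    and three members yield reflexivity, totality and transitivity; the strict part is then
    taken. *)
Lemma well_ordering (T : Type) : exists R, strict_well_order T R.
Proof.
  destruct (wochoice.well_ordering_principle (boolp.boolp_classicType__canonical__eqtype_Equality T))
    as [R HR].
  simpl in R.
  assert (HQ : forall Q : T -> Prop, (exists x, Q x) ->
            exists z, Q z /\ (forall x, Q x -> R z x = true) /\
              forall z', Q z' -> (forall x, Q x -> R z' x = true) -> z = z').
  { intros Q [x Hx].
    destruct (HR (fun y => boolp.asbool (Q y))) as [z [[Hz Hmin] Hu]].
    - exists x. exact (boolp.asboolT Hx).
    - exists z. split; [exact (boolp.asboolW Hz)|]. split.
      + intros y Hy. apply Hmin. exact (boolp.asboolT Hy).
      + intros z' Hz' Hm. apply Hu. split; [exact (boolp.asboolT Hz')|].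
        intros y Hy. apply Hm. exact (boolp.asboolW Hy). }
  assert (refl : forall x, R x x = true).
  { intros x. destruct (HQ (fun y => y = x)) as [z [Hz [Hm _]]]; [eauto|]. subst. auto. }
  assert (total : forall x y, R x y = true \/ R y x = true).
  { intros x y. destruct (HQ (fun z => z = x \/ z = y)) as [z [[-> | ->] [Hm _]]]; eauto. }
  assert (anti : forall x y, R x y = true -> R y x = true -> x = y).
  { intros x y Hxy Hyx. destruct (HQ (fun z => z = x \/ z = y)) as [z [_ [_ Hu]]]; [eauto|].
    rewrite <- (Hu x), <- (Hu y); auto; intros t [-> | ->]; auto. }
  exists (fun x y => R x y = true /\ x <> y). split; [|split; [|split]].
  - tauto.
  - intros x y z [Hxy nxy] [Hyz nyz]. split.
    + destruct (HQ (fun t => t = x \/ t = y \/ t = z)) as [t [[-> | [-> | ->]] [Hm _]]]; eauto.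
      * destruct nxy. auto.
      * destruct nyz. auto.
    + intros ->. apply nxy. auto.
  - intros x y. destruct (classic (x = y)); [tauto|].
    destruct (total x y); [left | right; right]; auto.
  - intros x. apply NNPP. intros Hx.
    destruct (HQ (fun y => ~ Acc (fun x y => R x y = true /\ x <> y) y)) as [z [Hz [Hm _]]];
      [eauto|].
    apply Hz. constructor. intros y [Hyz nyz]. apply NNPP. intros Hy.
    apply nyz. auto.
Qed.

(** If some segment is as large as [T], pull the order back along an injection into the least such
    segment; minimality makes the result an initial ordinal. *)
Lemma cardinal_order (T : Type) :
  exists R, strict_well_order T R /\ forall x, ~ le_card T (seg R x).
Proof.
  destruct (well_ordering T) as [R HR].
  destruct (classic (exists x, le_card T (seg R x))) as [H | H].
  - destruct (wf_least R _ (proj2 (proj2 (proj2 HR))) H) as [x [[f Hf] Hmin]].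
    set (g := fun t => proj1_sig (f t)).
    assert (Hg : injective g). { intros u v e. apply Hf, sig_ext, e. }
    exists (fun u v => R (g u) (g v)). split; [apply swo_pullback; assumption|].
    intros u Hu. apply (Hmin (g u)); [apply (proj2_sig (f u))|].
    apply (le_card_trans _ _ _ Hu).
    exists (fun v : seg (fun u v => R (g u) (g v)) u =>
              exist (fun y => R y (g u)) (g (proj1_sig v)) (proj2_sig v)).
    intros v w e. apply sig_ext, Hg. exact (f_equal (@proj1_sig _ _) e).
  - exists R. split; [exact HR|]. intros x Hx. apply H. eauto.
Qed.

Lemma le_card_total A B : le_card A B \/ le_card B A.
Proof.
  destruct (cardinal_order A) as [R [HR _]].
  destruct (card_dichotomy R B HR) as [H | [w H]]; [auto | right].
  exact (le_card_trans _ _ _ H (le_card_sig _)).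
Qed.

(** * Finite and infinite types; squares, lists and sums *)

Definition finite_type (T : Type) : Prop := exists l : list T, forall t, In t l.

Lemma nat_strict_well_order : strict_well_order nat lt.
Proof.
  split; [|split; [|split]].
  - intros x. lia.
  - intros x y z. lia.
  - intros x y. lia.
  - exact lt_wf.
Qed.

Lemma finite_or_infinite T : le_card nat T \/ finite_type T.
Proof.
  destruct (card_dichotomy lt T nat_strict_well_order) as [H | [n H]]; [auto | right].
  destruct (classic (inhabited T)) as [[t0] | HT].
  - destruct (le_card_surj H t0) as [g Hg].
    exists (map (fun k => match lt_dec k n with
                          | left p => g (exist _ k p) | right _ => t0 end) (List.seq 0 n)).
    intros t. destruct (Hg t) as [[k p] <-]. apply in_map_iff. exists k. split.
    + destruct (lt_dec k n) as [q | q]; [|contradiction]. f_equal. apply sig_ext. reflexivity.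
    + apply in_seq. lia.
  - exists []. intros t. destruct (HT (inhabits t)).
Qed.

Lemma nat_not_le_finite T : finite_type T -> ~ le_card nat T.
Proof.
  intros [l Hl] [f Hf].
  assert (H : length (map f (List.seq 0 (S (length l)))) <= length l).
  { apply NoDup_incl_length.
    - apply FinFun.Injective_map_NoDup; [exact Hf | apply seq_NoDup].
    - intros t _. apply Hl. }
  rewrite length_map, length_seq in H. lia.
Qed.

Lemma finite_prod A B : finite_type A -> finite_type B -> finite_type (A * B).
Proof.
  intros [l Hl] [l' Hl']. exists (list_prod l l'). intros [a b]. apply in_prod; auto.
Qed.

Lemma finite_sum A B : finite_type A -> finite_type B -> finite_type (A + B).
Proof.
  intros [l Hl] [l' Hl']. exists (map inl l ++ map inr l'). intros [a | b];
    apply in_or_app; [left | right]; apply in_map; auto.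
Qed.

Lemma finite_option A : finite_type A -> finite_type (option A).
Proof.
  intros [l Hl]. exists (None :: map Some l). intros [a |]; [right; apply in_map; auto | now left].
Qed.

(** Hilbert's hotel: shifting an embedded copy of [nat] by one frees [f 0] for [None]. *)
Lemma option_le_card T : le_card nat T -> le_card (option T) T.
Proof.
  intros [f Hf].
  pose (g := fun o : option T => match o with
     | None => f 0
     | Some t => match excluded_middle_informative (exists n, f n = t) with
                 | left H => f (S (proj1_sig (constructive_indefinite_description _ H)))
                 | right _ => t end end).
  assert (Hg : forall t, (exists n, f n = t /\ g (Some t) = f (S n)) \/
                         ((forall n, f n <> t) /\ g (Some t) = t)).
  { intros t. unfold g. destruct (excluded_middle_informative (exists n, f n = t)) as [H | H].
    - left. destruct (constructive_indefinite_description _ H) as [n Hn]. simpl. eauto.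
    - right. split; [|reflexivity]. intros n e. apply H. eauto. }
  assert (HN : forall t, g (Some t) <> f 0).
  { intros t. destruct (Hg t) as [[n [_ ->]] | [H ->]].
    - intros e. apply Hf in e. discriminate e.
    - intros e. exact (H 0 (eq_sym e)). }
  exists g. intros [x |] [y |] e.
  - f_equal. destruct (Hg x) as [[n [<- E]] | [H E]], (Hg y) as [[n' [<- E']] | [H' E']];
      rewrite E, E' in e.
    + apply Hf in e. congruence.
    + destruct (H' _ e).
    + destruct (H _ (eq_sym e)).
    + exact e.
  - destruct (HN x e).
  - destruct (HN y (eq_sym e)).
  - reflexivity.
Qed.

Lemma swo_slexprod {A B} (RA : A -> A -> Prop) (RB : B -> B -> Prop) :
  strict_well_order A RA -> strict_well_order B RB ->
  strict_well_order (A * B) (slexprod A B RA RB).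
Proof.
  intros [irA [trA [triA wfA]]] [irB [trB [triB wfB]]]. split; [|split; [|split]].
  - intros x H. inversion H; subst; [eapply irA | eapply irB]; eassumption.
  - intros x y z H1 H2. inversion H1; subst; inversion H2; subst;
      constructor; (assumption || (eapply trA; eassumption) || (eapply trB; eassumption)).
  - intros [a b] [a' b']. destruct (triA a a') as [H | [<- | H]].
    + left. now constructor.
    + destruct (triB b b') as [H | [<- | H]].
      * left. now constructor.
      * right. now left.
      * right. right. now constructor.
    + right. right. now constructor.
  - now apply wf_slexprod.
Qed.

(** The inductive step of the theorem that an infinite cardinal equals its square. If the square did
    not embed, [card_dichotomy] would embed [V] into a proper segment of a well-order of the
    pairs. *)
Lemma square_step {V} (Q : V -> V -> Prop) :
  strict_well_order V Q -> le_card nat V -> (forall m, ~ le_card V (seg Q m)) ->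
  (forall m, le_card nat (seg Q m) -> le_card (seg Q m * seg Q m) (seg Q m)) ->
  le_card (V * V) V.
Proof.
  intros HQ Hinf Hcard IH.
  pose (mx := fun a b => if excluded_middle_informative (Q a b) then b else a).
  pose (key := fun p : V * V => (mx (fst p) (snd p), p)).
  (* Goedel's ordering of pairs: the predecessors of a pair with maximum m lie in
     the square of the closed segment below m. *)
  destruct (card_dichotomy (fun p q => slexprod _ _ Q (slexprod _ _ Q Q) (key p) (key q)) V)
    as [H | [[a b] H]]; [|exact H|].
  - apply swo_pullback.
    + intros p q e. injection e as _ e. exact e.
    + apply swo_slexprod; [exact HQ | apply swo_slexprod; exact HQ].
  - exfalso. destruct HQ as [irr [tr [tri _]]].
    set (m := mx a b) in *.
    assert (Hmx : forall u v, ~ Q m (mx u v) -> ~ Q m u /\ ~ Q m v).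
    { intros u v. unfold mx. destruct (excluded_middle_informative (Q u v)) as [q | q]; intros h.
      - split; [|exact h]. intros h'. apply h. eapply tr; eassumption.
      - split; [exact h|]. intros h'. apply h. destruct (tri u v) as [q' | [-> | q']].
        + contradiction.
        + exact h'.
        + eapply tr; eassumption. }
    assert (H1 : le_card (seg (fun p q => slexprod _ _ Q (slexprod _ _ Q Q) (key p) (key q)) (a, b))
              ({u | ~ Q m u} * {u | ~ Q m u})).
    { assert (Hin : forall p, slexprod _ _ Q (slexprod _ _ Q Q) (key p) (key (a, b)) ->
                ~ Q m (fst p) /\ ~ Q m (snd p)).
      { intros p Hp. apply Hmx. intros h. unfold key in Hp. simpl in Hp. fold m in Hp.
        inversion Hp; subst.
        - apply (irr m). eapply tr; eassumption.
        - match goal with e : mx _ _ = m |- _ => rewrite e in h end. exact (irr _ h). }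
      exists (fun p => (exist (fun u => ~ Q m u) _ (proj1 (Hin _ (proj2_sig p))),
                        exist (fun u => ~ Q m u) _ (proj2 (Hin _ (proj2_sig p))))).
      intros p q e. apply sig_ext. injection e as e1 e2.
      destruct (proj1_sig p), (proj1_sig q). simpl in *. congruence. }
    assert (H2 : le_card {u | ~ Q m u} (option (seg Q m))).
    { exists (fun u => match excluded_middle_informative (Q (proj1_sig u) m) with
                       | left q => Some (exist (fun y => Q y m) _ q) | right _ => None end).
      intros [u Hu] [v Hv] e. apply sig_ext. simpl in *.
      destruct (excluded_middle_informative (Q u m)), (excluded_middle_informative (Q v m));
        try discriminate e.
      - injection e. auto.
      - destruct (tri u m) as [? | [-> | ?]]; try contradiction.
        destruct (tri v m) as [? | [-> | ?]]; try contradiction. reflexivity. }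
    assert (H3 := le_card_trans _ _ _ H (le_card_trans _ _ _ H1 (le_card_prod _ _ _ _ H2 H2))).
    destruct (finite_or_infinite (seg Q m)) as [Hm | Hm].
    + apply (Hcard m). apply (le_card_trans _ _ _ H3).
      assert (H4 := option_le_card _ Hm).
      exact (le_card_trans _ _ _ (le_card_prod _ _ _ _ H4 H4) (IH m Hm)).
    + apply (nat_not_le_finite (option (seg Q m) * option (seg Q m))).
      * apply finite_prod; apply finite_option; exact Hm.
      * exact (le_card_trans _ _ _ Hinf H3).
Qed.

Definition seg_rel {W} (R : W -> W -> Prop) (x : W) : seg R x -> seg R x -> Prop :=
  fun u v => R (proj1_sig u) (proj1_sig v).

Lemma seg_rel_swo {W} (R : W -> W -> Prop) x :
  strict_well_order W R -> strict_well_order (seg R x) (seg_rel R x).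
Proof. apply (swo_pullback R (@proj1_sig _ _)). intros u v. apply sig_ext. Qed.

Lemma seg_seg_rel_le {W} (R : W -> W -> Prop) x (m : seg R x) :
  le_card (seg (seg_rel R x) m) (seg R (proj1_sig m)).
Proof.
  exists (fun u => exist (fun y => R y (proj1_sig m)) (proj1_sig (proj1_sig u)) (proj2_sig u)).
  intros u v e. apply sig_ext, sig_ext. exact (f_equal (@proj1_sig _ _) e).
Qed.

Lemma seg_le_seg_seg_rel {W} (R : W -> W -> Prop) x (m : seg R x) :
  strict_well_order W R -> le_card (seg R (proj1_sig m)) (seg (seg_rel R x) m).
Proof.
  intros [_ [tr _]]. unshelve eexists.
  - intros [u Hu]. unshelve eexists; [exists u; exact (tr _ _ _ Hu (proj2_sig m)) | exact Hu].
  - intros [u Hu] [v Hv] e. apply sig_ext.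
    exact (f_equal (fun z => proj1_sig (proj1_sig z)) e).
Qed.

(** By induction on [x]: a segment that embeds into a smaller one inherits its square bound;
    otherwise the segment is an initial ordinal and [square_step] applies. *)
Lemma seg_square {W} (R : W -> W -> Prop) (x : W) :
  strict_well_order W R -> le_card nat (seg R x) -> le_card (seg R x * seg R x) (seg R x).
Proof.
  intros HR. destruct (HR) as [irr [tr [tri wf]]].
  induction (wf x) as [x _ IH]. intros Hx.
  destruct (classic (exists y, R y x /\ le_card (seg R x) (seg R y))) as [[y [Ryx Hy]] | Hcard].
  - apply (le_card_trans _ _ _ (le_card_prod _ _ _ _ Hy Hy)).
    apply (le_card_trans _ _ _ (IH y Ryx (le_card_trans _ _ _ Hx Hy))).
    apply le_card_sig_incl. intros z Hz. eapply tr; eassumption.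
  - apply (square_step (seg_rel R x)); [now apply seg_rel_swo | exact Hx | |].
    + intros m Hm. apply Hcard. exists (proj1_sig m). split; [exact (proj2_sig m)|].
      exact (le_card_trans _ _ _ Hm (seg_seg_rel_le R x m)).
    + intros m Hm. pose proof (seg_seg_rel_le R x m) as E1.
      apply (le_card_trans _ _ _ (le_card_prod _ _ _ _ E1 E1)).
      apply (le_card_trans _ _ _ (IH _ (proj2_sig m) (le_card_trans _ _ _ Hm E1))).
      now apply seg_le_seg_seg_rel.
Qed.

Lemma square_le_card T : le_card nat T -> le_card (T * T) T.
Proof.
  intros HT. destruct (cardinal_order T) as [R [HR Hc]].
  apply (square_step R HR HT Hc). intros m. now apply seg_square.
Qed.

(** Iterated pairing is injective only among lists of equal length, so the length is stored next to
    it. *)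
Lemma list_le_card T : le_card nat T -> le_card (list T) T.
Proof.
  intros HT. destruct (square_le_card T HT) as [j Hj]. destruct (HT) as [f Hf].
  pose (enc := fix enc (l : list T) : T :=
     match l with [] => f 0 | x :: l' => j (x, enc l') end).
  assert (Henc : forall l l', length l = length l' -> enc l = enc l' -> l = l').
  { induction l as [|x l IH]; intros [|y l'] el e; try discriminate el; [reflexivity|].
    simpl in e. apply Hj in e. injection e as -> e. f_equal. apply IH; [|exact e].
    injection el. auto. }
  exists (fun l => j (f (length l), enc l)). intros l l' e. apply Hj in e.
  injection e as e1 e2. apply Henc; [apply Hf|]; assumption.
Qed.

(** Both summands embed into the larger one, [Z]. If [Z] is infinite, the sum embeds into [Z * Z]
    and hence into [Z]; if [Z] is finite, so is the sum. *)
Lemma sum_not_le_card P X Y :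
  le_card nat P -> ~ le_card P X -> ~ le_card P Y -> ~ le_card P (X + Y).
Proof.
  intros HP HX HY H.
  assert (D : forall Z, le_card X Z -> le_card Y Z -> ~ le_card P Z -> False).
  { intros Z [f Hf] [g Hg] HZ. destruct (finite_or_infinite Z) as [[k Hk] | HZf].
    - apply HZ, (le_card_trans _ _ _ H), (le_card_trans _ (Z * Z)).
      + exists (fun s => match s with inl x => (k 0, f x) | inr y => (k 1, g y) end).
        intros [x | y] [x' | y'] e;
          pose proof (f_equal fst e) as e1; pose proof (f_equal snd e) as e2; simpl in e1, e2;
          try (apply Hk in e1; discriminate e1); f_equal; auto.
      + apply square_le_card. exists k. exact Hk.
    - apply (nat_not_le_finite (Z + Z)).
      + now apply finite_sum.
      + apply (le_card_trans _ _ _ HP), (le_card_trans _ _ _ H).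
        exists (fun s => match s with inl x => inl (f x) | inr y => inr (g y) end).
        intros [x | y] [x' | y'] e; try discriminate e; injection e as e1; f_equal; auto. }
  destruct (le_card_total X Y) as [h | h].
  - exact (D Y h (le_card_refl Y) HY).
  - exact (D X (le_card_refl X) h HX).
Qed.

(** * Cofinality and regular cardinals *)

Lemma cofinality {W} (R : W -> W -> Prop) (a : W) :
  strict_well_order W R -> (exists b, R b a) ->
  (forall b, R b a -> exists c, R b c /\ R c a) ->
  exists (x : W) (c : seg R x -> W),
    is_regular_cardinal (seg R x) (seg_rel R x) /\
    (forall u, R (c u) a) /\
    (forall u v, seg_rel R x u v -> R (c u) (c v)) /\
    (forall b, R b a -> exists u, ~ R (c u) b).
Proof.
  intros HR [b0 Hb0] nomax. destruct (HR) as [irr [tr [tri wf]]].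
  pose (cofinal := fun (T : Type) (c : T -> W) =>
    (forall u, R (c u) a) /\ forall b, R b a -> exists u, ~ R (c u) b).
  (* The shortest segment with a map cofinal below [a], monotone or not. By [F], no family with
     fewer indices is cofinal, which gives both that the segment is a cardinal and that it is
     regular. *)
  destruct (wf_least R (fun x => exists c, cofinal (seg R x) c) wf) as [x [[c [Hca Hcc]] Hmin]].
  { exists a, (@proj1_sig _ _). split; [intros u; exact (proj2_sig u)|].
    intros b Hb. exists (exist _ b Hb). apply irr. }
  assert (F : forall T (d : T -> W) y, cofinal T d -> R y x -> le_card T (seg R y) -> False).
  { intros T d y [Hd1 Hd2] Hy HT. destruct (Hd2 b0 Hb0) as [t0 _].
    destruct (le_card_surj HT t0) as [g Hg]. apply (Hmin y Hy).
    exists (fun u => d (g u)). split; [intros u; apply Hd1|].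
    intros b Hb. destruct (Hd2 b Hb) as [t Ht]. destruct (Hg t) as [u <-]. eauto. }
  assert (Hmax : forall b v, R b a -> R v a -> exists z, R z a /\ ~ R z b /\ ~ R z v).
  { intros b v Hb Hv. destruct (classic (R b v)) as [h | h].
    - exists v. repeat split; [exact Hv | | apply irr]. intros h'. apply (irr b). eapply tr; eassumption.
    - exists b. repeat split; [exact Hb | apply irr | exact h]. }
  assert (Hinf : le_card nat (seg R x)).
  { destruct (finite_or_infinite (seg R x)) as [H | [l Hl]]; [exact H | exfalso].
    assert (B : forall l : list (seg R x), exists b, R b a /\ forall u, In u l -> R (c u) b).
    { induction l0 as [|u l0 [b [Hb IH]]]; [exists b0; split; [exact Hb0 | intros u []]|].
      destruct (Hmax b (c u) Hb (Hca u)) as [z [Hz [z1 z2]]].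
      destruct (nomax z Hz) as [z' [Hzz Hz']]. exists z'. split; [exact Hz'|].
      assert (Q : forall v, ~ R z v -> R v z').
      { intros v Hv. destruct (tri v z) as [h | [-> | h]]; [|exact Hzz|contradiction].
        eapply tr; eassumption. }
      intros v [<- | Hv]; [now apply Q|].
      eapply tr; [exact (IH v Hv) | now apply Q]. }
    destruct (B l) as [b [Hb Hbl]]. destruct (Hcc b Hb) as [u Hu]. apply Hu, Hbl, Hl. }
  (* Make the map increasing: each value is not below [c u] and lies above all earlier values. If
     this breaks down, the earlier values are cofinal with too few indices, against [F]. *)
  destruct (wf_choice (seg_rel R x)
     (fun u s v => R v a /\ ~ R v (c u) /\ forall w, seg_rel R x w u -> R (s w) v) a)
    as [[d Hd] | [u [s [Hs Hno]]]].
  - apply seg_rel_swo, HR.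
  - intros u s s' v E [H1 [H2 H3]]. repeat split; auto.
    intros w Hw. rewrite <- (E w Hw). auto.
  - assert (Hdc : forall b, R b a -> exists u, ~ R (d u) b).
    { intros b Hb. destruct (Hcc b Hb) as [u Hu]. exists u. intros h.
      destruct (Hd u) as [_ [h2 _]].
      destruct (tri (d u) (c u)) as [h' | [h' | h']]; [contradiction | rewrite h' in h; contradiction|].
      apply Hu. eapply tr; eassumption. }
    exists x, d. split; [split; [split; [|split]|]|split; [|split]].
    + now apply seg_rel_swo.
    + exact Hinf.
    + intros y. split; [apply le_card_sig|]. intros Hy.
      apply (F _ c (proj1_sig y) (conj Hca Hcc) (proj2_sig y)).
      exact (le_card_trans _ _ _ Hy (seg_seg_rel_le R x y)).
    + intros S HS. destruct (card_dichotomy _ {y | S y} (seg_rel_swo R x HR)) as [H | [w H]].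
      * exact H.
      * exfalso. apply (F {y | S y} (fun y => d (proj1_sig y)) (proj1_sig w)).
        -- split; [intros y; apply Hd|]. intros b Hb. destruct (Hdc b Hb) as [u Hu].
           destruct (HS u) as [y [Sy Hy]]. exists (exist _ y Sy). simpl. intros h. apply Hu.
           destruct (tri (proj1_sig u) (proj1_sig y)) as [h' | [h' | h']].
           ++ eapply tr; [|exact h]. apply (Hd y). exact h'.
           ++ apply sig_ext in h'. subst. exact h.
           ++ destruct (Hy h').
        -- exact (proj2_sig w).
        -- exact (le_card_trans _ _ _ H (seg_seg_rel_le R x w)).
    + intros u. apply Hd.
    + intros u v Huv. apply (Hd v), Huv.
    + exact Hdc.
  - exfalso. apply (F (seg (seg_rel R x) u) (fun w => s (proj1_sig w)) (proj1_sig u)).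
    + split; [intros w; apply (Hs _ (proj2_sig w))|].
      intros b Hb. apply NNPP. intros h. destruct (Hmax b (c u) Hb (Hca u)) as [z [Hz [z1 z2]]].
      apply (Hno z). repeat split; [exact Hz | exact z2|].
      intros w Hw. assert (h' : R (s w) b).
      { apply NNPP. intros h'. apply h. exists (exist _ w Hw). exact h'. }
      destruct (tri b z) as [q | [<- | q]]; [eapply tr; eassumption | exact h' | contradiction].
    + exact (proj2_sig u).
    + apply seg_seg_rel_le.
Qed.

Lemma regular_no_max {W} (R : W -> W -> Prop) :
  is_regular_cardinal W R -> forall i, exists j, R i j.
Proof.
  intros [[_ [Hinf _]] Hreg] i. apply NNPP. intros H.
  apply (nat_not_le_finite {y : W | y = i}).
  - exists [exist (fun y => y = i) i eq_refl]. intros [y ->]. now left.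
  - apply (le_card_trans _ _ _ Hinf), Hreg. intros x. exists i. split; [reflexivity|]. eauto.
Qed.

Lemma regular_list_bound {W} (R : W -> W -> Prop) :
  is_regular_cardinal W R -> forall l : list W, exists j, forall i, In i l -> R i j.
Proof.
  intros HW. pose proof (regular_no_max R HW) as nomax.
  destruct HW as [[[irr [tr [tri wf]]] [[f _] _]] _].
  induction l as [|i l [j IH]]; [exists (f 0); intros i []|].
  destruct (classic (R j i)) as [h | h].
  - destruct (nomax i) as [k Hk]. exists k. intros i' [<- | Hi']; [exact Hk|].
    eapply tr; [exact (IH i' Hi')|]. eapply tr; eassumption.
  - destruct (nomax j) as [k Hk]. exists k. intros i' [<- | Hi'].
    + destruct (tri i j) as [h' | [-> | h']]; [eapply tr; eassumption | exact Hk | contradiction].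
    + eapply tr; [exact (IH i' Hi') | exact Hk].
Qed.

(** * Almost inclusion and the cardinals p and t *)

Lemma subq_star_trans A B C : subq_star A B -> subq_star B C -> subq_star A C.
Proof.
  intros [N HN] [M HM]. exists (max N M). intros n Hn HA. apply HM; [lia|]. apply HN; [lia | exact HA].
Qed.

Lemma subq_star_incl (A B : nat -> Prop) : (forall n, A n -> B n) -> subq_star A B.
Proof. intros H. exists 0. auto. Qed.

Lemma subq_star_and A B C :
  subq_star A B -> subq_star A C -> subq_star A (fun n => B n /\ C n).
Proof.
  intros [N HN] [M HM]. exists (max N M). intros n Hn HA. split; [apply HN | apply HM]; auto; lia.
Qed.

Lemma subq_star_forall_list {X} (A : nat -> Prop) (C : X -> nat -> Prop) (l : list X) :
  (forall x, In x l -> subq_star A (C x)) -> subq_star A (fun n => forall x, In x l -> C x n).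
Proof.
  induction l as [|x l IH]; intros H; [apply subq_star_incl; intros n _ x []|].
  destruct (H x (or_introl eq_refl)) as [N HN].
  destruct IH as [M HM]; [intros y Hy; apply H; now right|].
  exists (max N M). intros n Hn HA y [<- | Hy]; [apply HN | apply HM]; auto; lia.
Qed.

Lemma infinite_subq_star A B : infinite_set A -> subq_star A B -> infinite_set B.
Proof.
  intros HA [N HN] n. destruct (HA (max n N)) as [m [Hm Am]].
  exists m. split; [lia|]. apply HN; [lia | exact Am].
Qed.

Lemma infinite_inter A B : infinite_set A -> subq_star A B -> infinite_set (fun n => A n /\ B n).
Proof.
  intros HA HB. apply (infinite_subq_star A); [exact HA|].
  apply subq_star_and; [|exact HB]. apply subq_star_incl. auto.
Qed.

(** Without a pseudo-intersection the sets [C x] would form a [p_family] of size at most that of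
    [X]. *)
Lemma small_pseudo_intersection P X (C : X -> nat -> Prop) :
  is_p P -> ~ le_card P X ->
  (forall l : list X, infinite_set (fun n => forall x, In x l -> C x n)) ->
  exists A, infinite_set A /\ forall x, subq_star A (C x).
Proof.
  intros [_ Hmin] HX Hfip. apply NNPP. intros Hno. apply HX.
  apply (le_card_trans _ {A | exists x, A = C x}).
  - apply Hmin. split; [|split].
    + intros A [x ->] n. destruct (Hfip [x] n) as [m [Hm H]]. exists m. split; [exact Hm|].
      apply H. now left.
    + intros l Hl.
      assert (E : exists xs, l = map C xs).
      { induction l as [|A l IH]; [now exists []|].
        destruct (Hl A (or_introl eq_refl)) as [x ->].
        destruct IH as [xs ->]; [intros A HA; apply Hl; now right|]. now exists (x :: xs). }
      destruct E as [xs ->]. intros n. destruct (Hfip xs n) as [m [Hm H]].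
      exists m. split; [exact Hm|]. intros A HA. apply in_map_iff in HA.
      destruct HA as [x [<- Hx]]. auto.
    + intros [A [HA H]]. apply Hno. exists A. split; [exact HA|]. eauto.
  - apply (surj_le_card (fun x => exist (fun A => exists x, A = C x) (C x) (ex_intro _ x eq_refl))).
    intros [A [x Hx]]. exists x. apply sig_ext. symmetry. exact Hx.
Qed.

Lemma decreasing_pseudo_intersection P W (R : W -> W -> Prop) (s : W -> nat -> Prop) :
  p_lt_t P -> strict_well_order W R -> le_card W P ->
  (forall a, infinite_set (s a)) -> (forall a b, R a b -> subq_star (s b) (s a)) ->
  exists A, infinite_set A /\ forall a, subq_star A (s a).
Proof.
  intros Hpt HR HW Hinf Hdec. apply NNPP. intros Hno.
  destruct (Hpt W R s) as [_ H]; [|exact (H HW)]. exact (conj HR (conj Hinf (conj Hdec Hno))).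
Qed.

Lemma p_family_enum P : is_p P -> exists B : P -> nat -> Prop,
  (forall l : list P, infinite_set (fun n => forall a, In a l -> B a n)) /\
  ~ (exists A, infinite_set A /\ forall a, subq_star A (B a)).
Proof.
  intros [[B [[Hinf [Hfip Hno]] [f [g [gf fg]]]]] _].
  exists (fun a => proj1_sig (g a)). split.
  - intros l n. destruct (Hfip (map (fun a => proj1_sig (g a)) l)) with (n := n) as [m [Hm H]].
    + intros A HA. apply in_map_iff in HA. destruct HA as [a [<- _]]. exact (proj2_sig (g a)).
    + exists m. split; [exact Hm|]. intros a Ha. apply H. apply in_map_iff. eauto.
  - intros [A [HA H]]. apply Hno. exists A. split; [exact HA|]. intros C HC.
    specialize (H (f (exist _ C HC))). rewrite gf in H. exact H.
Qed.

Lemma p_infinite P : is_p P -> le_card nat P.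
Proof.
  intros HP. destruct (p_family_enum P HP) as [B [Hfip Hno]].
  destruct (finite_or_infinite P) as [H | [l Hl]]; [exact H | exfalso].
  apply Hno. exists (fun n => forall a, In a l -> B a n). split; [apply Hfip|].
  intros a. apply subq_star_incl. auto.
Qed.

(** From an injection of [P] into [nat], the intersections of the finitely many [B a] with
    [j a <= n] decrease along the natural numbers, and p < t gives a pseudo-intersection of the
    whole family. *)
Lemma p_uncountable P : is_p P -> p_lt_t P -> ~ le_card P nat.
Proof.
  intros HP Hpt [j Hj]. destruct (p_family_enum P HP) as [B [Hfip Hno]].
  assert (L : forall n, exists l, forall a, j a <= n -> In a l).
  { induction n as [|n [l IH]].
    - destruct (classic (exists a, j a = 0)) as [[a Ha] | H].
      + exists [a]. intros b Hb. left. apply Hj. lia.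
      + exists []. intros b Hb. apply H. exists b. lia.
    - destruct (classic (exists a, j a = S n)) as [[a Ha] | H].
      + exists (a :: l). intros b Hb. destruct (Nat.eq_dec (j b) (S n)) as [e | e].
        * left. apply Hj. lia.
        * right. apply IH. lia.
      + exists l. intros b Hb. destruct (Nat.eq_dec (j b) (S n)) as [e | e].
        * destruct H. eauto.
        * apply IH. lia. }
  apply Hno.
  destruct (decreasing_pseudo_intersection P nat lt (fun n m => forall a, j a <= n -> B a m))
    as [A [HA H]].
  - exact Hpt.
  - exact nat_strict_well_order.
  - exact (p_infinite P HP).
  - intros n. destruct (L n) as [l Hl]. apply (infinite_subq_star _ _ (Hfip l)).
    apply subq_star_incl. auto.
  - intros n m Hnm. apply subq_star_incl. intros k Hk a Ha. apply Hk. lia.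
  - exists A. split; [exact HA|]. intros a. apply (subq_star_trans _ _ _ (H (j a))).
    apply subq_star_incl. auto.
Qed.

(** Code pairs by numbers and take a pseudo-intersection of the conditions as sets of pairs; [Y] is
    its projection and [g] selects one point over each [n]. *)
Lemma small_pseudo_graph P X (C : X -> nat -> nat -> Prop) :
  is_p P -> p_lt_t P -> ~ le_card P X ->
  (forall l N, exists n m, N <= n /\ forall x, In x l -> C x n m) ->
  exists Y g, infinite_set Y /\ forall x, subq_star Y (fun n => C x n (g n)).
Proof.
  intros HP Hpt HX Hfip.
  (* The additional conditions [inr k] push the first coordinates to infinity, so that the
     projection is infinite. *)
  pose (D := fun (s : X + nat) z => match s with
     | inl x => C x (fst (of_nat z)) (snd (of_nat z)) | inr k => k <= fst (of_nat z) end).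
  destruct (small_pseudo_intersection P (X + nat) D HP) as [A [HA H]].
  - apply sum_not_le_card; auto; [now apply p_infinite | now apply p_uncountable].
  - intros l n.
    assert (L : exists lX N, n <= N /\
       forall s, In s l -> match s with inl x => In x lX | inr k => k <= N end).
    { induction l as [|s l [lX [N [HN IH]]]]; [exists [], n; split; [lia | intros s []]|].
      destruct s as [x | k].
      - exists (x :: lX), N. split; [exact HN|]. intros s [<- | Hs]; [now left|].
        specialize (IH s Hs). destruct s; [now right | exact IH].
      - exists lX, (max N k). split; [lia|]. intros s [<- | Hs]; [lia|].
        specialize (IH s Hs). destruct s; [exact IH | lia]. }
    destruct L as [lX [N [HN L]]]. destruct (Hfip lX N) as [k [m [Hk Hm]]].
    exists (to_nat (k, m)). pose proof (to_nat_non_decreasing k m) as Hle. split; [lia|].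
    intros s Hs. specialize (L s Hs). unfold D. rewrite cancel_of_to. simpl.
    destruct s; [auto | lia].
  - pose (g := fun n => epsilon (inhabits 0) (fun m => A (to_nat (n, m)))).
    exists (fun n => exists m, A (to_nat (n, m))), g. split.
    + intros N. destruct (infinite_inter A _ HA (H (inr N)) 0) as [z [_ [Az Hz]]].
      exists (fst (of_nat z)). split; [exact Hz|]. exists (snd (of_nat z)).
      rewrite <- surjective_pairing, cancel_to_of. exact Az.
    + intros x. destruct (H (inl x)) as [N HN]. exists N. intros n Hn Hex.
      apply (epsilon_spec (inhabits 0)) in Hex. fold (g n) in Hex.
      pose proof (to_nat_non_decreasing n (g n)) as Hle.
      specialize (HN (to_nat (n, g n)) ltac:(lia) Hex). unfold D in HN.
      rewrite cancel_of_to in HN. exact HN.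
Qed.

(* The poset of infinite sets under almost inclusion is t-distributive. *)
Lemma open_dense_inter P X (D : X -> (nat -> Prop) -> Prop) :
  p_lt_t P -> le_card X P ->
  (forall x A A', D x A -> subq_star A' A -> D x A') ->
  (forall x A, infinite_set A -> exists A', infinite_set A' /\ subq_star A' A /\ D x A') ->
  exists A, infinite_set A /\ forall x, D x A.
Proof.
  intros Hpt HX Hopen Hdense. destruct (cardinal_order X) as [R [HR _]].
  assert (HT : infinite_set (fun _ => True)). { intros n. eauto. }
  destruct (wf_choice R (fun x s A => infinite_set A /\ D x A /\ forall y, R y x -> subq_star A (s y))
    (fun _ => True)) as [[s Hs] | [x [s [Hs Hno]]]].
  - apply HR.
  - intros x s s' A E [H1 [H2 H3]]. repeat split; auto. intros y Hy. rewrite <- (E y Hy). auto.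
  - destruct (decreasing_pseudo_intersection P X R s) as [A [HA H]]; auto.
    + intros x. apply Hs.
    + intros x y Hxy. apply (Hs y). exact Hxy.
    + exists A. split; [exact HA|]. intros x. apply (Hopen x (s x)); [apply Hs | apply H].
  - exfalso.
    destruct (decreasing_pseudo_intersection P (seg R x) (seg_rel R x) (fun y => s (proj1_sig y)))
      as [A [HA H]].
    + exact Hpt.
    + now apply seg_rel_swo.
    + exact (le_card_trans _ _ _ (le_card_sig _) HX).
    + intros y. apply (Hs _ (proj2_sig y)).
    + intros y z Hyz. apply (Hs _ (proj2_sig z)). exact Hyz.
    + destruct (Hdense x A HA) as [A' [HA' [Hsub HD]]]. apply (Hno A'). split; [exact HA'|].
      split; [exact HD|]. intros y Hy. apply (subq_star_trans _ _ _ Hsub).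
      exact (H (exist _ y Hy)).
Qed.

(** * Sparse sets and domination *)

Lemma strictly_increasing_lt (e : nat -> nat) :
  (forall k, e k < e (S k)) -> forall i j, i < j -> e i < e j.
Proof. intros He i j H. induction H as [|j _ IH]; [apply He|]. specialize (He j). lia. Qed.

Lemma increasing_ge (e : nat -> nat) : (forall k, e k < e (S k)) -> forall k, k <= e k.
Proof. intros He. induction k as [|k IH]; [lia|]. specialize (He k). lia. Qed.

Lemma sparse_subset (A : nat -> Prop) (g : nat -> nat) : infinite_set A ->
  exists e : nat -> nat, (forall k, A (e k)) /\ forall k, g (e k) < e (S k) /\ e k < e (S k).
Proof.
  intros HA. destruct (choice _ HA) as [next Hnext].
  exists (fix e k := match k with 0 => next 0 | S k' => next (S (g (e k') + e k')) end). split.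
  - intros [|k]; apply Hnext.
  - intros k. match goal with |- context [next (S (g ?x + ?x))] =>
      destruct (Hnext (S (g x + x))) as [H _] end. lia.
Qed.

(** The sets that jump past the monotone majorant [gm x] between any two of their large elements are
    open and dense for almost inclusion. One infinite set that does so for all [x] gives the
    bound. *)
Lemma domination P X (g : X -> nat -> nat) :
  p_lt_t P -> le_card X P -> exists G, forall x, le_star (g x) G.
Proof.
  intros Hpt HX.
  pose (gm := fun x => fix gm n := match n with 0 => g x 0 | S n' => max (gm n') (g x (S n')) end).
  assert (Hgm : forall x n, g x n <= gm x n). { intros x [|n]; simpl; lia. }
  assert (Hmono : forall x n m, n <= m -> gm x n <= gm x m).
  { intros x n m H. induction H; simpl; lia. }
  destruct (open_dense_inter P X
     (fun x A => exists N, forall m n, N <= m -> A m -> A n -> m < n -> gm x m < n))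
    as [A [HA H]]; auto.
  - intros x A A' [N HN] [M HM]. exists (max N M). intros m n Hm Am An Hmn.
    apply HN; auto; [lia | apply HM; auto; lia | apply HM; auto; lia].
  - intros x A HA. destruct (sparse_subset A (gm x) HA) as [e [He1 He2]].
    assert (He : forall i j, i < j -> e i < e j).
    { apply strictly_increasing_lt. intros k. apply He2. }
    assert (Hge : forall k, k <= e k).
    { apply increasing_ge. intros k. apply He2. }
    exists (fun n => exists k, n = e k). split; [|split].
    + intros n. exists (e n). eauto.
    + apply subq_star_incl. intros n [k ->]. auto.
    + exists 0. intros m n _ [i ->] [j ->] Hij.
      assert (i < j). { destruct (le_lt_dec j i) as [h | h]; [|exact h].
        destruct (Nat.eq_dec i j) as [-> | h']; [lia|]. specialize (He j i). lia. }
      assert (e (S i) <= e j).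
      { destruct (Nat.eq_dec (S i) j) as [-> | h']; [lia|]. specialize (He (S i) j). lia. }
      destruct (He2 i). lia.
  (* The bound at [n] is the second of two successive choices from [A]: the first is at least [n],
     and the second exceeds [gm x] at the first. *)
  - destruct (choice _ HA) as [next Hnext]. exists (fun n => next (S (next n))).
    intros x. destruct (H x) as [N HN]. exists N. intros n Hn.
    destruct (Hnext n) as [h1 h2], (Hnext (S (next n))) as [h3 h4].
    specialize (HN (next n) (next (S (next n))) ltac:(lia) h2 h4 h3). specialize (Hgm x n).
    specialize (Hmono x n (next n) h1). lia.
Qed.

(** * Hereditarily unfilled gaps *)

Lemma positive_chain P (R : P -> P -> Prop) :
  is_p P -> p_lt_t P -> strict_well_order P R -> (forall x, ~ le_card P (seg R x)) ->
  exists (K : Type) (RK : K -> K -> Prop) (A : K -> nat -> Prop) (B : list P -> nat -> Prop),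
    is_regular_cardinal K RK /\ le_card K P /\ ~ le_card P K /\
    (forall i l, infinite_set (fun n => A i n /\ B l n)) /\
    (forall i j, RK i j -> subq_star (A j) (A i)) /\
    ~ (exists Z, (forall i, subq_star Z (A i)) /\ forall l, infinite_set (fun n => Z n /\ B l n)).
Proof.
  intros HP Hpt HR Hcard. destruct (p_family_enum P HP) as [B [Hfip Hno]].
  pose (BL := fun (l : list P) n => forall a, In a l -> B a n).
  pose (pos := fun A => forall l, infinite_set (fun n => A n /\ BL l n)).
  destruct (HR) as [irr [tr [tri wf]]].
  destruct (wf_choice R (fun a s A => pos A /\ subq_star A (B a) /\
      forall b, R b a -> subq_star A (s b)) (fun _ => True) wf) as [[s Hs] | [a [s [Hs Hfail]]]].
  - intros a s s' A E [H1 [H2 H3]]. repeat split; auto. intros b Rb. rewrite <- (E b Rb). auto.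
  - exfalso. destruct (decreasing_pseudo_intersection P P R s) as [A [HA H]].
    + exact Hpt.
    + exact HR.
    + apply le_card_refl.
    + intros a. destruct (Hs a) as [h _]. apply (infinite_subq_star _ _ (h [])).
      apply subq_star_incl. tauto.
    + intros a b Hab. apply (Hs b). exact Hab.
    + apply Hno. exists A. split; [exact HA|]. intros a.
      apply (subq_star_trans _ _ _ (H a)). apply Hs.
  (* A positive pseudo-intersection of the earlier sets stays positive after intersection with
     [B a], so it would continue the recursion. *)
  - assert (Hfail' : forall A, pos A -> (forall b, R b a -> subq_star A (s b)) -> False).
    { intros A HA H. apply (Hfail (fun n => A n /\ B a n)). split; [|split].
      - intros l. apply (infinite_subq_star _ _ (HA (a :: l))). apply subq_star_incl.
        intros n [h1 h2]. split; [split; [exact h1 | apply h2; now left]|].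
        intros b Hb. apply h2. now right.
      - apply subq_star_incl. tauto.
      - intros b Hb. apply (subq_star_trans _ A); [apply subq_star_incl; tauto | auto]. }
    (* The failing stage is a limit: at the first stage the full set, and after a last [b] the set
       [s b], would be a positive pseudo-intersection. *)
    destruct (cofinality R a HR) as [x [c [Hreg [Hca [Hcm Hcc]]]]].
    + apply NNPP. intros H. apply (Hfail' (fun _ => True)).
      * intros l. apply (infinite_subq_star _ _ (Hfip l)). apply subq_star_incl. unfold BL. tauto.
      * intros b Hb. destruct H. eauto.
    + intros b Hb. apply NNPP. intros H. apply (Hfail' (s b)).
      * apply (Hs b Hb).
      * intros b' Hb'. destruct (tri b b') as [h | [<- | h]].
        -- destruct H. eauto.
        -- apply subq_star_incl. auto.
        -- apply (Hs b Hb). exact h.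
    + exists (seg R x), (seg_rel R x), (fun u => s (c u)), BL.
      split; [exact Hreg|]. split; [apply le_card_sig|]. split; [apply Hcard|].
      split; [intros i; apply (Hs (c i) (Hca i))|].
      split; [intros i j Hij; apply (Hs (c j) (Hca j)), Hcm, Hij|].
      intros [Z [HZ Hpos]]. apply (Hfail' Z Hpos). intros b Hb.
      destruct (Hcc b Hb) as [u Hu]. destruct (tri (c u) b) as [h | [<- | h]].
      * contradiction.
      * apply HZ.
      * apply (subq_star_trans _ _ _ (HZ u)). apply (Hs (c u) (Hca u)). exact h.
Qed.

(* [up] lies below [lo] almost everywhere on [Y0], and no function separates the two
   families on any infinite subset of [Y0]. *)
Definition hereditary_gap {I J} (Y0 : nat -> Prop) (lo : I -> nat -> nat) (up : J -> nat -> nat) :=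
  infinite_set Y0 /\
  (forall i j, subq_star Y0 (fun n => up j n <= lo i n)) /\
  ~ (exists Y g, infinite_set Y /\ subq_star Y Y0 /\
       (forall j, subq_star Y (fun n => up j n <= g n)) /\
       (forall i, subq_star Y (fun n => g n <= lo i n))).

(** Iterated Cantor decoding: a single number [m] codes a whole rank function on an interval, so
    that rank functions can be selected by [small_pseudo_graph]. *)
Fixpoint digit (m k : nat) : nat :=
  match k with 0 => fst (of_nat m) | S k' => digit (snd (of_nat m)) k' end.

Lemma digit_surj k (r : nat -> nat) : exists m, forall j, j < k -> digit m j = r j.
Proof.
  revert r. induction k as [|k IH]; intros r; [exists 0; lia|].
  destruct (IH (fun j => r (S j))) as [m Hm]. exists (to_nat (r 0, m)).
  intros [|j] Hj; cbn [digit]; rewrite cancel_of_to; cbn [fst snd]; [reflexivity|]. apply Hm. lia.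
Qed.

Lemma filter_length_lt {X} (p q : X -> bool) (l : list X) i :
  (forall x, In x l -> p x = true -> q x = true) -> In i l -> p i = false -> q i = true ->
  length (filter p l) < length (filter q l).
Proof.
  intros Hpq Hi pi qi.
  assert (L : forall l', (forall x, In x l' -> p x = true -> q x = true) ->
              length (filter p l') <= length (filter q l')).
  { induction l' as [|x l' IH]; intros H; simpl; [lia|].
    specialize (IH (fun y Hy => H y (or_intror Hy))). pose proof (H x (or_introl eq_refl)) as Hx.
    destruct (p x); [rewrite Hx by reflexivity; simpl; lia | destruct (q x); simpl; lia]. }
  induction l as [|x l IH]; [destruct Hi|]. simpl.
  destruct Hi as [-> | Hi].
  - rewrite pi, qi. simpl. specialize (L l (fun y Hy => Hpq y (or_intror Hy))). lia.
  - specialize (IH (fun y Hy => Hpq y (or_intror Hy)) Hi).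
    pose proof (Hpq x (or_introl eq_refl)) as Hx.
    destruct (p x); [rewrite Hx by reflexivity; simpl; lia | destruct (q x); simpl; lia].
Qed.

Lemma bounded_below_index (F : nat -> nat) k : exists t, forall x, x <= k -> F x < t.
Proof.
  induction k as [|k [t IH]].
  - exists (S (F 0)). intros x Hx. replace x with 0 by lia. lia.
  - exists (max t (S (F (S k)))). intros x Hx. destruct (Nat.eq_dec x (S k)) as [-> | h]; [lia|].
    specialize (IH x ltac:(lia)). lia.
Qed.

(* A finite chain of sets is the chain of sublevel sets of one rank function: rank a point
   by the number of members of the chain that miss it. *)
Lemma chain_rank {K} (A : K -> nat -> Prop) (l : list K) (n b : nat) :
  (forall i j, In i l -> In j l -> (forall x, n <= x -> A i x -> A j x) \/
                                   (forall x, n <= x -> A j x -> A i x)) ->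
  exists m, forall i, In i l -> exists t, forall x, n <= x <= b -> (A i x <-> digit m (x - n) < t).
Proof.
  intros Hchain.
  pose (miss := fun x i => if excluded_middle_informative (A i x) then false else true).
  pose (r := fun x => length (filter (miss x) l)).
  destruct (digit_surj (S b) (fun k => r (n + k))) as [m Hm].
  assert (Hm' : forall x, n <= x <= b -> digit m (x - n) = r x).
  { intros x Hx. rewrite Hm by lia. f_equal. lia. }
  (* If [A i] contains [x] but not [y], comparability shows that every member missing [x] also
     misses [y], and [A i] itself makes the inequality strict. *)
  assert (Hr : forall i x y, In i l -> n <= x -> n <= y -> A i x -> ~ A i y -> r x < r y).
  { intros i x y Hi Hx Hy Ax Ay. apply (filter_length_lt _ _ _ i); [|exact Hi| |].
    - intros j Hj. unfold miss.
      destruct (excluded_middle_informative (A j x)) as [h | h]; [discriminate|].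
      destruct (excluded_middle_informative (A j y)) as [h' | h']; [|reflexivity].
      destruct (Hchain i j Hi Hj) as [c | c]; [destruct h; auto | destruct Ay; auto].
    - unfold miss. destruct (excluded_middle_informative (A i x)); tauto.
    - unfold miss. destruct (excluded_middle_informative (A i y)); tauto. }
  exists m. intros i Hi.
  (* The threshold is the least rank of a point outside [A i], or a number above all ranks if there
     is no such point. *)
  destruct (classic (exists y, n <= y /\ ~ A i y)) as [[y Hy] | Hall].
  - destruct (wf_least lt (fun t => exists y, n <= y /\ ~ A i y /\ t = r y) lt_wf)
      as [t [[z [Hz [Az ->]]] Hmin]].
    + exists (r y), y. tauto.
    + exists (r z). intros x Hx. rewrite Hm' by exact Hx. split; intros h.
      * apply (Hr i); auto. lia.
      * apply NNPP. intros h'. apply (Hmin _ h). exists x. repeat split; auto. lia.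
  - exists (S (length l)). intros x Hx. rewrite Hm' by exact Hx. split; intros h.
    + unfold r. pose proof (filter_length_le (miss x) l). lia.
    + apply NNPP. intros h'. apply Hall. exists x. split; [lia | exact h'].
Qed.

(** Dominate twice: for fixed [j], the functions sending [n] to a common point of [A i] and [B j]
    beyond [n]; then the resulting bounds [Gj j]. *)
Lemma chain_intervals P K J (A : K -> nat -> Prop) (B : J -> nat -> Prop) :
  p_lt_t P -> le_card K P -> le_card J P ->
  (forall i j, infinite_set (fun n => A i n /\ B j n)) ->
  exists G, forall i j, exists N, forall n, N <= n -> exists x, n <= x <= G n /\ A i x /\ B j x.
Proof.
  intros Hpt HK HJ Hpos.
  assert (H1 : forall j, exists G, forall i, exists N, forall n, N <= n ->
             exists x, n <= x <= G n /\ A i x /\ B j x).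
  { intros j.
    destruct (choice (fun (p : K * nat) x => snd p <= x /\ A (fst p) x /\ B j x)) as [g Hg].
    { intros [i n]. apply (Hpos i j n). }
    destruct (domination P K (fun i n => g (i, n)) Hpt HK) as [G HG]. exists G. intros i.
    destruct (HG i) as [N HN]. exists N. intros n Hn. exists (g (i, n)).
    destruct (Hg (i, n)) as [h1 h2]. simpl in *. specialize (HN n Hn). repeat split; tauto || lia. }
  destruct (choice _ H1) as [Gj HGj].
  destruct (domination P J Gj Hpt HJ) as [G HG]. exists G. intros i j.
  destruct (HGj j i) as [N HN], (HG j) as [M HM]. exists (max N M). intros n Hn.
  destruct (HN n ltac:(lia)) as [x [Hx HAB]]. specialize (HM n ltac:(lia)).
  exists x. split; [lia | exact HAB].
Qed.

Lemma chain_gap P K (RK : K -> K -> Prop) J (A : K -> nat -> Prop) (B : J -> nat -> Prop) :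
  is_p P -> p_lt_t P -> is_regular_cardinal K RK -> le_card K P -> ~ le_card P K -> le_card J P ->
  (forall i j, infinite_set (fun n => A i n /\ B j n)) ->
  (forall i j, RK i j -> subq_star (A j) (A i)) ->
  ~ (exists Z, (forall i, subq_star Z (A i)) /\ forall j, infinite_set (fun n => Z n /\ B j n)) ->
  exists Y0 (f : K -> nat -> nat) (h : J -> nat -> nat),
    hereditary_gap Y0 f h /\ forall i j, RK i j -> subq_star Y0 (fun n => f j n <= f i n).
Proof.
  intros HP Hpt Hreg HK HPK HJ Hpos Hdec Hno.
  destruct (Hreg) as [[[_ [_ [tri _]]] [[k0 _] _]] _]. pose (i0 := k0 0).
  destruct (chain_intervals P K J A B) as [G HG]; auto.
  (* Here [m] codes a rank function on [[n, G n]]. Finitely many [A i] form a genuine chain beyond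
     the largest of their pairwise moduli [M], where [chain_rank] supplies the code. *)
  destruct (small_pseudo_graph P K (fun i n m => exists t, forall x, n <= x <= G n ->
     (A i x <-> digit m (x - n) < t))) as [Y0 [r [HY0 Hr]]]; auto.
  { intros l N.
    assert (HM : forall p : K * K, exists M,
       (forall x, M <= x -> A (fst p) x -> A (snd p) x) \/
       (forall x, M <= x -> A (snd p) x -> A (fst p) x)).
    { intros [i j]. simpl. destruct (tri i j) as [h | [-> | h]].
      - destruct (Hdec _ _ h) as [M H]. eauto.
      - exists 0. auto.
      - destruct (Hdec _ _ h) as [M H]. eauto. }
    destruct (choice _ HM) as [M HM'].
    pose (n := max N (list_max (map M (list_prod l l)))).
    destruct (chain_rank A l n (G n)) as [m Hm].
    - intros i j Hi Hj.
      assert (Hle : M (i, j) <= n).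
      { unfold n. apply Nat.max_le_iff. right.
        pose proof (proj1 (list_max_le (map M (list_prod l l)) _) (le_n _)) as F.
        rewrite Forall_forall in F. apply F. apply in_map. now apply in_prod. }
      destruct (HM' (i, j)) as [h | h]; [left | right]; intros x Hx; apply h; simpl; lia.
    - exists n, m. split; [lia | exact Hm]. }
  pose (rank := fun n x => digit (r n) (x - n)).
  (* [f i n] is the least strict upper bound of the ranks of [A i] on the interval; taking the least
     threshold makes [f] almost decreasing in [i]. *)
  destruct (choice (fun (p : K * nat) t =>
     (forall x, snd p <= x <= G (snd p) -> A (fst p) x -> rank (snd p) x < t) /\
     forall t', (forall x, snd p <= x <= G (snd p) -> A (fst p) x -> rank (snd p) x < t') -> t <= t'))
    as [f Hf].
  { intros [i n]. simpl.
    destruct (wf_least lt (fun t => forall x, n <= x <= G n -> A i x -> rank n x < t) lt_wf)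
      as [t [Ht Hmin]].
    - destruct (bounded_below_index (rank n) (G n)) as [t Ht]. exists t. intros x Hx _. apply Ht. lia.
    - exists t. split; [exact Ht|]. intros t' Ht'.
      destruct (le_lt_dec t t') as [h | h]; [exact h|]. destruct (Hmin t' h Ht'). }
  (* [h j n] is one more than the least rank of [B j] on the interval, with 0 as the value if [B j]
     misses it. *)
  destruct (choice (fun (p : J * nat) k =>
     ((exists x, snd p <= x <= G (snd p) /\ B (fst p) x) ->
       exists x, snd p <= x <= G (snd p) /\ B (fst p) x /\ rank (snd p) x < k) /\
     forall x, snd p <= x <= G (snd p) -> B (fst p) x -> k <= S (rank (snd p) x)))
    as [h Hh].
  { intros [j n]. simpl.
    destruct (classic (exists x, n <= x <= G n /\ B j x)) as [[x Hx] | Hx].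
    - destruct (wf_least lt (fun k => exists x, n <= x <= G n /\ B j x /\ k = S (rank n x)) lt_wf)
        as [k [[y [Hy [By ->]]] Hmin]].
      + exists (S (rank n x)), x. tauto.
      + exists (S (rank n y)). split; [intros _; exists y; auto|]. intros z Hz Bz.
        destruct (le_lt_dec (S (rank n y)) (S (rank n z))) as [q | q]; [exact q|].
        destruct (Hmin _ q). eauto.
    - exists 0. split; [contradiction | lia]. }
  assert (Hiff : forall i, subq_star Y0 (fun n => forall x, n <= x <= G n ->
                   (A i x <-> rank n x < f (i, n)))).
  { intros i. apply (subq_star_trans _ _ _ (Hr i)). apply subq_star_incl. intros n [t Ht] x Hx.
    destruct (Hf (i, n)) as [f1 f2]. simpl in *. split; intros q; [auto|].
    apply Ht; [exact Hx|]. fold (rank n x).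
    enough (f (i, n) <= t) by lia. apply f2. intros y Hy Ay. now apply Ht. }
  exists Y0, (fun i n => f (i, n)), (fun j n => h (j, n)). split; [split; [|split]|].
  - exact HY0.
  - intros i j. destruct (HG i j) as [N HN], (Hiff i) as [M HM]. exists (max N M). intros n Hn Yn.
    destruct (HN n ltac:(lia)) as [x [Hx [Ax Bx]]].
    apply (HM n ltac:(lia) Yn x Hx) in Ax.
    destruct (Hh (j, n)) as [_ h2]. specialize (h2 x Hx Bx). simpl in h2. lia.
  - intros [Y [g [HY [HYY0 [Hup Hlo]]]]]. apply Hno.
    (* A separator [g] yields the union of its sublevel sets over the intervals: it is almost below
       every [A i] because g is below [f], and it meets every [B j] because [g] is above [h]. *)
    exists (fun x => exists n, Y n /\ n <= x <= G n /\ rank n x < g n). split.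
    + intros i. destruct (subq_star_and _ _ _ (Hlo i) (subq_star_trans _ _ _ HYY0 (Hiff i)))
        as [N HN].
      (* Intervals starting by [N] all end before [M], so a point beyond [M] lies only in intervals
         where the estimates hold. *)
      destruct (bounded_below_index G N) as [M HM]. exists M. intros x Hx [n [Yn [Hn Hg]]].
      assert (N <= n). { destruct (le_lt_dec N n); [assumption|]. specialize (HM n ltac:(lia)). lia. }
      destruct (HN n H Yn) as [q1 q2]. apply q2; [exact Hn | lia].
    + intros j N. destruct (HG i0 j) as [M HM]. destruct (Hup j) as [M' HM'].
      destruct (HY (max N (max M M'))) as [n [Hn Yn]].
      destruct (Hh (j, n)) as [h1 _]. simpl in h1.
      destruct h1 as [x [Hx [Bx Rx]]].
      * destruct (HM n ltac:(lia)) as [x [Hx [_ Bx]]]. eauto.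
      * specialize (HM' n ltac:(lia) Yn). exists x. split; [lia|]. split; [|exact Bx].
        exists n. split; [exact Yn|]. split; [exact Hx | lia].
  - intros i j Hij. destruct (Hdec i j Hij) as [N HN]. exists N. intros n Hn _.
    apply (Hf (j, n)). intros x Hx Ax. simpl in *. apply (proj1 (Hf (i, n))); [exact Hx|].
    apply HN; [lia | exact Ax].
Qed.

(** * Making both sides strictly monotone *)

Lemma increasing_family P K (RK : K -> K -> Prop) :
  p_lt_t P -> well_founded RK -> le_card K P ->
  exists u : K -> nat -> nat, forall i j, RK i j -> lt_star (u i) (u j).
Proof.
  intros Hpt wf HK.
  destruct (wf_choice RK (fun j s x => forall i, RK i j -> lt_star (s i) x) (fun _ => 0) wf)
    as [[u Hu] | [j [s [_ Hno]]]].
  - intros j s s' x E H i Hi. rewrite <- (E i Hi). auto.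
  - exists u. auto.
  - exfalso. destruct (domination P (seg RK j) (fun i => s (proj1_sig i)) Hpt) as [G HG].
    + exact (le_card_trans _ _ _ (le_card_sig _) HK).
    + apply (Hno (fun n => S (G n))). intros i Hi. destruct (HG (exist _ i Hi)) as [N HN].
      exists N. intros n Hn. specialize (HN n Hn). simpl in HN. lia.
Qed.

(* Refine [f] lexicographically by a strictly decreasing family with values in [0, L]. *)
Lemma strict_gap P K (RK : K -> K -> Prop) J Y0 (f : K -> nat -> nat) (h : J -> nat -> nat) :
  p_lt_t P -> well_founded RK -> le_card K P -> hereditary_gap Y0 f h ->
  (forall i j, RK i j -> subq_star Y0 (fun n => f j n <= f i n)) ->
  exists (lo : K -> nat -> nat) (up : J -> nat -> nat),
    hereditary_gap Y0 lo up /\ forall i j, RK i j -> subq_star Y0 (fun n => lo j n < lo i n).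
Proof.
  intros Hpt wf HK [HY0 [Hle Hno]] Hdec.
  destruct (increasing_family P K RK Hpt wf HK) as [u Hu].
  destruct (domination P K u Hpt HK) as [L HL].
  (* The low digit in base [S (L n)] breaks ties; as [L] dominates every [u j], the truncated
     subtraction remains strict almost everywhere. *)
  exists (fun i n => f i n * S (L n) + (L n - u i n)), (fun j n => h j n * S (L n)).
  split; [split; [exact HY0 | split]|].
  - intros i j. apply (subq_star_trans _ _ _ (Hle i j)). apply subq_star_incl. intros n Hn. nia.
  (* Dropping the low digit of a separator, by division, separates the original families. *)
  - intros [Y [g [HY [HYY0 [Hup Hlo]]]]]. apply Hno. exists Y, (fun n => g n / S (L n)).
    repeat split; auto.
    + intros j. apply (subq_star_trans _ _ _ (Hup j)). apply subq_star_incl. intros n Hn.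
      apply Nat.div_le_lower_bound; lia.
    + intros i. apply (subq_star_trans _ _ _ (Hlo i)). apply subq_star_incl. intros n Hn.
      apply Nat.lt_succ_r. apply Nat.Div0.div_lt_upper_bound; nia.
  - intros i j Hij. destruct (Hdec i j Hij) as [N1 H1], (Hu i j Hij) as [N2 H2], (HL j) as [N3 H3].
    exists (max N1 (max N2 N3)). intros n Hn Yn.
    specialize (H1 n ltac:(lia) Yn). specialize (H2 n ltac:(lia)). specialize (H3 n ltac:(lia)).
    nia.
Qed.

(* Below the strictly decreasing [lo], any single [lo j] interpolates finitely many conditions,
   so fewer than p conditions can be met simultaneously on some infinite set. *)
Lemma interpolate P K (RK : K -> K -> Prop) X (Y0 : nat -> Prop) (lo : K -> nat -> nat)
    (Yx : X -> nat -> Prop) (u : X -> nat -> nat) :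
  is_p P -> p_lt_t P -> is_regular_cardinal K RK -> ~ le_card P K -> ~ le_card P X ->
  (forall i j, RK i j -> subq_star Y0 (fun n => lo j n < lo i n)) ->
  (forall x i, subq_star (Yx x) (fun n => u x n < lo i n)) ->
  (forall l : list X, exists Y, infinite_set Y /\ subq_star Y Y0 /\
     forall x, In x l -> subq_star Y (Yx x)) ->
  exists Y g, infinite_set Y /\
    (forall x, subq_star Y (fun n => Yx x n /\ u x n < g n)) /\
    (forall i, subq_star Y (fun n => g n < lo i n)).
Proof.
  intros HP Hpt Hreg HK HX Hdec Hlt Hdir.
  destruct (small_pseudo_graph P (K + X) (fun s n m => match s with
     | inl i => m < lo i n | inr x => Yx x n /\ u x n < m end)) as [Y [g [HY Hg]]]; auto.
  - apply sum_not_le_card; auto. now apply p_infinite.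
  - intros l N.
    assert (L : exists lK lX, forall s, In s l ->
       match s with inl i => In i lK | inr x => In x lX end).
    { induction l as [|s l [lK [lX IH]]]; [exists [], []; intros s []|].
      destruct s as [i | x]; [exists (i :: lK), lX | exists lK, (x :: lX)];
        intros s [<- | Hs]; try (now left); specialize (IH s Hs); destruct s; auto; now right. }
    destruct L as [lK [lX L]].
    destruct (regular_list_bound RK Hreg lK) as [j Hj]. destruct (Hdir lX) as [Y [HY [HY0 HYx]]].
    assert (E : subq_star Y (fun n => (forall i, In i lK -> lo j n < lo i n) /\
                                      (forall x, In x lX -> Yx x n /\ u x n < lo j n))).
    { apply subq_star_and.
      - apply subq_star_forall_list. intros i Hi. apply (subq_star_trans _ _ _ HY0).
        apply Hdec. auto.
      - apply subq_star_forall_list. intros x Hx. apply subq_star_and; [auto|].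
        apply (subq_star_trans _ _ _ (HYx x Hx)). apply Hlt. }
    destruct (infinite_subq_star _ _ HY E N) as [n [Hn [E1 E2]]].
    exists n, (lo j n). split; [exact Hn|]. intros s Hs. specialize (L s Hs).
    destruct s; auto.
  - exists Y, g. split; [exact HY|]. split; [intros x; apply (Hg (inr x)) | intros i; apply (Hg (inl i))].
Qed.

(** Recursion on pairs of a domain and a function on it, lying above [h a] and all earlier
    functions. A pseudo-intersection of the domains serves as [Y1]; a separator for the new
    functions also separates the smaller [h]. *)
Lemma increasing_gap P (R : P -> P -> Prop) K (RK : K -> K -> Prop) Y0
    (lo : K -> nat -> nat) (h : P -> nat -> nat) :
  is_p P -> p_lt_t P -> strict_well_order P R -> (forall x, ~ le_card P (seg R x)) ->
  is_regular_cardinal K RK -> ~ le_card P K ->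
  hereditary_gap Y0 lo h ->
  (forall i j, RK i j -> subq_star Y0 (fun n => lo j n < lo i n)) ->
  exists Y1 (up : P -> nat -> nat), subq_star Y1 Y0 /\ hereditary_gap Y1 lo up /\
    (forall a b, R a b -> subq_star Y1 (fun n => up a n < up b n)) /\
    (forall i a, subq_star Y1 (fun n => up a n < lo i n)).
Proof.
  intros HP Hpt HR Hcard Hreg HPK [HY0 [Hle Hno]] Hdec.
  destruct (HR) as [irr [tr [tri wf]]].
  assert (Hlt : forall a i, subq_star Y0 (fun n => h a n < lo i n)).
  { intros a i. destruct (regular_no_max RK Hreg i) as [j Hj].
    apply (subq_star_trans _ _ _ (subq_star_and _ _ _ (Hle j a) (Hdec i j Hj))).
    apply subq_star_incl. intros n. lia. }
  destruct (wf_choice R (fun a s (x : (nat -> Prop) * (nat -> nat)) =>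
      infinite_set (fst x) /\ subq_star (fst x) Y0 /\
      subq_star (fst x) (fun n => h a n < snd x n) /\
      (forall i, subq_star (fst x) (fun n => snd x n < lo i n)) /\
      forall b, R b a -> subq_star (fst x) (fun n => fst (s b) n /\ snd (s b) n < snd x n))
      (Y0, fun _ => 0) wf)
    as [[s Hs] | [a [s [Hs Hfail]]]].
  - intros a s s' x E [H1 [H2 [H3 [H4 H5]]]]. repeat split; auto.
    intros b Hb. rewrite <- (E b Hb). auto.
  - assert (Hdecr : forall a b, R a b -> subq_star (fst (s b)) (fst (s a))).
    { intros a b Hab. destruct (Hs b) as [_ [_ [_ [_ H]]]].
      apply (subq_star_trans _ _ _ (H a Hab)). apply subq_star_incl. tauto. }
    destruct (decreasing_pseudo_intersection P P R (fun a => fst (s a))) as [Y1 [HY1 H1]]; auto.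
    { apply le_card_refl. }
    { intros a. apply Hs. }
    assert (H1' : forall a Q, subq_star (fst (s a)) Q -> subq_star Y1 Q).
    { intros a Q. apply subq_star_trans, H1. }
    assert (HY10 : subq_star Y1 Y0).
    { destruct (p_infinite P HP) as [k _]. apply (H1' (k 0)). apply Hs. }
    exists Y1, (fun a => snd (s a)). split; [exact HY10|]. split; [split; [exact HY1 | split]|split].
    + intros i a. apply (H1' a). destruct (Hs a) as [_ [_ [_ [H _]]]].
      apply (subq_star_trans _ _ _ (H i)), subq_star_incl. intros n. lia.
    + intros [Y [g [HY [HYY1 [Hup Hlo]]]]]. apply Hno. exists Y, g. split; [exact HY|].
      split; [exact (subq_star_trans _ _ _ HYY1 HY10)|]. split; [|exact Hlo].
      intros a. destruct (Hs a) as [_ [_ [H _]]].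
      apply (subq_star_trans _ _ _ (subq_star_and _ _ _ (Hup a)
               (subq_star_trans _ _ _ HYY1 (H1' a _ H)))).
      apply subq_star_incl. intros n. lia.
    + intros a b Hab. apply (H1' b). destruct (Hs b) as [_ [_ [_ [_ H]]]].
      apply (subq_star_trans _ _ _ (H a Hab)), subq_star_incl. tauto.
    + intros i a. apply (H1' a). apply Hs.
  - exfalso.
    (* Fewer than p conditions: one for each earlier stage, and the summand [unit] for [h a]
       itself. *)
    destruct (interpolate P K RK (seg R a + unit) Y0 lo
      (fun x => match x with inl b => fst (s (proj1_sig b)) | inr _ => Y0 end)
      (fun x => match x with inl b => snd (s (proj1_sig b)) | inr _ => h a end))
      as [Y [g [HY [Hx Hlo]]]]; auto.
    + apply sum_not_le_card; auto; [now apply p_infinite|].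
      intros H. apply (nat_not_le_finite unit); [exists [tt]; intros []; now left|].
      exact (le_card_trans _ _ _ (p_infinite P HP) H).
    + intros [b | []] i; [apply (Hs _ (proj2_sig b)) | apply Hlt].
    (* Among finitely many earlier stages the latest has a domain almost contained in the others;
       the empty list is handled by [Y0]. *)
    + assert (L : forall l : list (seg R a),
         (l = []) \/ exists b, R b a /\ forall c, In c l -> subq_star (fst (s b)) (fst (s (proj1_sig c)))).
      { induction l as [|c l IH]; [now left|]. right.
        destruct IH as [-> | [b [Hb IH]]].
        - exists (proj1_sig c). split; [exact (proj2_sig c)|].
          intros c' [<- | []]. now apply subq_star_incl.
        - assert (Hsub : forall x y, R x a -> R y x -> subq_star (fst (s x)) (fst (s y))).
          { intros x y Hx Hy. destruct (Hs x Hx) as [_ [_ [_ [_ H]]]].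
            apply (subq_star_trans _ _ _ (H y Hy)), subq_star_incl. tauto. }
          destruct (tri b (proj1_sig c)) as [q | q].
          + exists (proj1_sig c). split; [exact (proj2_sig c)|].
            intros c' [<- | Hc']; [now apply subq_star_incl|].
            apply (subq_star_trans _ _ _ (Hsub _ _ (proj2_sig c) q)). auto.
          + exists b. split; [exact Hb|]. intros c' [<- | Hc']; [|auto].
            destruct q as [-> | q]; [now apply subq_star_incl | auto]. }
      intros l.
      assert (E : exists lS, forall x, In x l -> match x with inl b => In b lS | inr _ => True end).
      { induction l as [|x l [lS IH]]; [exists []; intros x []|].
        destruct x as [b | []].
        - exists (b :: lS). intros x [<- | Hx]; [now left|]. specialize (IH x Hx).
          destruct x; [now right | exact IH].
        - exists lS. intros x [<- | Hx]; auto. exact (IH x Hx). }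
      destruct E as [lS E]. destruct (L lS) as [-> | [b [Hb HL]]].
      * exists Y0. split; [exact HY0|]. split; [now apply subq_star_incl|].
        intros x Hx. specialize (E x Hx). destruct x; [destruct E | now apply subq_star_incl].
      * destruct (Hs b Hb) as [q1 [q2 _]]. exists (fst (s b)). split; [exact q1|].
        split; [exact q2|]. intros x Hx. specialize (E x Hx). destruct x; auto.
    + apply (Hfail (Y, g)). simpl. split; [exact HY|].
      split; [apply (subq_star_trans _ _ _ (Hx (inr tt))), subq_star_incl; tauto|].
      split; [apply (subq_star_trans _ _ _ (Hx (inr tt))), subq_star_incl; tauto|].
      split; [exact Hlo|]. intros b Hb. exact (Hx (inl (exist _ b Hb))).
Qed.

(** * Transfer to all of [nat] and the cut conditions *)

Lemma reindex_subq_star (e : nat -> nat) (Y Q : nat -> Prop) :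
  (forall k, e k < e (S k)) -> (forall k, Y (e k)) -> subq_star Y Q ->
  exists N, forall k, N <= k -> Q (e k).
Proof.
  intros He HY [N HN]. exists N. intros k Hk. apply HN; [|apply HY].
  pose proof (increasing_ge e He k). lia.
Qed.

(** A separator on [Y] is carried to the image of [Y] under [e] by the inverse of [e]. As the gap is
    hereditary, [e] may enumerate just a part of [Y1]. *)
Lemma reindex_gap {I J} Y1 (lo : I -> nat -> nat) (up : J -> nat -> nat) (e : nat -> nat) :
  (forall k, e k < e (S k)) -> (forall k, Y1 (e k)) -> hereditary_gap Y1 lo up ->
  hereditary_gap (fun _ => True) (fun i k => lo i (e k)) (fun j k => up j (e k)).
Proof.
  intros He HY1 [_ [Hle Hno]]. split; [|split].
  - intros n. eauto.
  - intros i j. destruct (reindex_subq_star e _ _ He HY1 (Hle i j)) as [N HN].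
    exists N. auto.
  - intros [Y [g [HY [_ [Hup Hlo]]]]]. apply Hno.
    pose (inv := fun m => epsilon (inhabits 0) (fun k => e k = m)).
    assert (Hmono := strictly_increasing_lt e He).
    assert (Hinv : forall k, inv (e k) = k).
    { intros k. assert (E : e (inv (e k)) = e k).
      { apply (epsilon_spec (inhabits 0) (fun k' => e k' = e k)). eauto. }
      destruct (lt_eq_lt_dec (inv (e k)) k) as [[h | h] | h]; [|exact h|];
        apply Hmono in h; lia. }
    assert (T : forall Q : nat -> nat -> Prop, subq_star Y (fun k => Q k (e k)) ->
              subq_star (fun m => exists k, Y k /\ m = e k) (fun m => Q (inv m) m)).
    { intros Q [N HN]. exists (e N). intros m Hm [k [Yk ->]]. rewrite Hinv. apply HN; [|exact Yk].
      destruct (le_lt_dec N k) as [h | h]; [exact h|]. apply Hmono in h. lia. }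
    exists (fun m => exists k, Y k /\ m = e k), (fun m => g (inv m)). split; [|split; [|split]].
    + intros n. destruct (HY n) as [k [Hk Yk]]. exists (e k).
      pose proof (increasing_ge e He k). split; [lia | eauto].
    + apply subq_star_incl. intros m [k [_ ->]]. apply HY1.
    + intros j. exact (T (fun k m => up j m <= g k) (Hup j)).
    + intros i. exact (T (fun k m => g k <= lo i m) (Hlo i)).
Qed.

(** Let [t] advance by one only once [n] has reached [G] at the next value; then [t] is unbounded,
    while [G (t n) <= n] holds from [G 0] on. *)
Lemma slow_inverse (G : nat -> nat) : exists t : nat -> nat,
  (forall k, exists N, forall n, N <= n -> k <= t n) /\ exists N, forall n, N <= n -> G (t n) <= n.
Proof.
  pose (t := fix t n := match n with
     | 0 => 0 | S n' => if le_dec (G (S (t n'))) (S n') then S (t n') else t n' end).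
  assert (mono : forall n m, n <= m -> t n <= t m).
  { intros n m H. induction H as [|m _ IH]; [lia|]. simpl. destruct (le_dec _ _); lia. }
  exists t. split.
  - induction k as [|k [N IH]]; [exists 0; lia|].
    exists (S (max N (G (S k)))). intros n Hn.
    destruct n as [|n]; [lia|]. specialize (IH n ltac:(lia)).
    destruct (Nat.eq_dec (t n) k) as [E | E].
    + simpl. rewrite E. destruct (le_dec _ _); lia.
    + specialize (mono n (S n) ltac:(lia)). lia.
  - exists (G 0). intros n Hn.
    assert (H : t n = 0 \/ G (t n) <= n).
    { clear Hn. induction n as [|n IH]; [now left|]. simpl.
      destruct (le_dec (G (S (t n))) (S n)); [now right | destruct IH; [now left | right; lia]]. }
    destruct H as [-> | H]; lia.
Qed.

(* A countable [lo] would be filled by its diagonal minimum, taken along an index growing slowly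
   enough for a function dominating all the moduli of [up a <= lo i]. *)
Lemma gap_uncountable P K (lo : K -> nat -> nat) (up : P -> nat -> nat) :
  p_lt_t P -> K -> hereditary_gap (fun _ => True) lo up -> ~ le_card K nat.
Proof.
  intros Hpt i0 [Hinf [Hle Hno]] [c Hc]. apply Hno.
  (* A modulus valid simultaneously for the finitely many [i] with [c i <= k]. *)
  assert (Hg : forall p : P * nat, exists N, forall n i, N <= n -> c i <= snd p ->
             up (fst p) n <= lo i n).
  { intros [a k]. simpl. induction k as [|k [N IH]].
    - destruct (classic (exists i, c i = 0)) as [[i Hi] | H].
      + destruct (Hle i a) as [N HN]. exists N. intros n j Hn Hj.
        replace j with i by (apply Hc; lia). auto.
      + exists 0. intros n j Hn Hj. destruct H. exists j. lia.
    - destruct (classic (exists i, c i = S k)) as [[i Hi] | H].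
      + destruct (Hle i a) as [M HM]. exists (max N M). intros n j Hn Hj.
        destruct (Nat.eq_dec (c j) (S k)) as [E | E].
        * replace j with i by (apply Hc; lia). apply HM; [lia | exact I].
        * apply IH; lia.
      + exists N. intros n j Hn Hj. apply IH; [lia|].
        assert (c j <> S k) by (intros E; apply H; eauto). lia. }
  destruct (choice _ Hg) as [g Hg'].
  destruct (domination P P (fun a k => g (a, k)) Hpt (le_card_refl P)) as [G HG].
  destruct (slow_inverse G) as [t [Ht1 [N0 Ht2]]].
  (* The minimum of [lo i n] over [c i <= t n]; it is attained once [t n] reaches [c i0], and is 0
     while no index qualifies. *)
  assert (Hmin : forall n, exists v, (forall i, c i <= t n -> v <= lo i n) /\
            (c i0 <= t n -> exists i, c i <= t n /\ v = lo i n)).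
  { intros n. destruct (classic (exists i, c i <= t n)) as [[i Hi] | H].
    - destruct (wf_least lt (fun v => exists i, c i <= t n /\ v = lo i n) lt_wf)
        as [v [Hv Hm]]; [eauto|].
      exists v. split; [|auto]. intros j Hj.
      destruct (le_lt_dec v (lo j n)) as [h | h]; [exact h|]. destruct (Hm _ h). eauto.
    - exists 0. split; [lia|]. intros h. destruct H. eauto. }
  destruct (choice _ Hmin) as [f Hf].
  exists (fun _ => True), f. split; [exact Hinf|]. split; [now apply subq_star_incl|]. split.
  - intros a. destruct (HG a) as [N1 HN1], (Ht1 (max N1 (c i0))) as [N2 HN2].
    exists (max N0 N2). intros n Hn _. specialize (HN2 n ltac:(lia)).
    specialize (HN1 (t n) ltac:(lia)). specialize (Ht2 n ltac:(lia)).
    destruct (Hf n) as [_ H]. destruct H as [i [Hi ->]]; [lia|].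
    apply (Hg' (a, t n)); simpl; lia.
  - intros i. destruct (Ht1 (c i)) as [N HN]. exists N. intros n Hn _. apply Hf. auto.
Qed.

(** An unbounded subset of [P] that is too small could be interpolated, giving a separator; hence
    [P] is regular. If [f] violates a cut condition, the infinite sets where [up a < f],
    respectively [f < lo i], almost decrease. By p < t they have a pseudo-intersection, on which [f]
    separates. *)
Lemma gap_peculiar P (R : P -> P -> Prop) K (RK : K -> K -> Prop)
    (lo : K -> nat -> nat) (up : P -> nat -> nat) :
  is_p P -> p_lt_t P -> strict_well_order P R -> (forall x, ~ le_card P (seg R x)) ->
  is_regular_cardinal K RK -> le_card K P -> ~ le_card P K ->
  hereditary_gap (fun _ => True) lo up ->
  (forall i j, RK i j -> lt_star (lo j) (lo i)) ->
  (forall a b, R a b -> lt_star (up a) (up b)) ->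
  (forall i a, lt_star (up a) (lo i)) ->
  peculiar_cut K RK P R lo up.
Proof.
  intros HP Hpt HR Hcard Hreg HK HPK [Hinf [_ Hno]] Hlo Hup Hlt.
  assert (star : forall f g, lt_star f g -> forall Y, subq_star Y (fun n => f n < g n)).
  { intros f g [N HN] Y. exists N. auto. }
  split; [exact Hreg|]. split; [split|split; [exact Hlo|split; [exact Hup|split; [exact Hlt|split]]]].
  - split; [exact HR|]. split; [now apply p_infinite|].
    intros x. split; [apply le_card_sig | apply Hcard].
  - intros S HS. apply NNPP. intros HPS. apply Hno.
    destruct (interpolate P K RK {y | S y} (fun _ => True) lo
       (fun _ _ => True) (fun x => up (proj1_sig x))) as [Y [g [HY [Hx Hi]]]]; auto.
    + intros l. exists (fun _ => True). split; [exact Hinf|]. split; intros; now apply subq_star_incl.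
    + exists Y, g. split; [exact HY|]. split; [now apply subq_star_incl|]. split.
      * intros a. destruct (HS a) as [y [Sy Hy]].
        apply (subq_star_trans _ (fun n => up y n < g n /\ up a n <= up y n)).
        -- apply subq_star_and.
           ++ apply (subq_star_trans _ _ _ (Hx (exist _ y Sy))), subq_star_incl. simpl. tauto.
           ++ destruct HR as [_ [_ [tri _]]]. destruct (tri a y) as [q | [-> | q]].
              ** apply (subq_star_trans _ _ _ (star _ _ (Hup _ _ q) Y)), subq_star_incl.
                 intros n. lia.
              ** now apply subq_star_incl.
              ** contradiction.
        -- apply subq_star_incl. intros n. lia.
      * intros i. apply (subq_star_trans _ _ _ (Hi i)), subq_star_incl. intros n. lia.
  - intros f Hf. apply NNPP. intros Hnot. apply Hno.
    destruct (decreasing_pseudo_intersection P P R (fun a n => up a n < f n)) as [Y [HY H]]; auto.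
    + apply le_card_refl.
    + intros a N. apply NNPP. intros q. apply Hnot. exists a, N. intros n Hn.
      destruct (le_lt_dec (f n) (up a n)) as [h | h]; [exact h|]. destruct q. eauto.
    + intros a b Hab. destruct (Hup a b Hab) as [N HN]. exists N. intros n Hn.
      specialize (HN n Hn). lia.
    + exists Y, f. split; [exact HY|]. split; [now apply subq_star_incl|]. split.
      * intros a. apply (subq_star_trans _ _ _ (H a)), subq_star_incl. intros n. lia.
      * intros i. destruct (Hf i) as [N HN]. exists N. auto.
  - intros f Hf. apply NNPP. intros Hnot. apply Hno.
    destruct (decreasing_pseudo_intersection P K RK (fun i n => f n < lo i n)) as [Y [HY H]]; auto.
    + apply Hreg.
    + intros i N. apply NNPP. intros q. apply Hnot. exists i, N. intros n Hn.
      destruct (le_lt_dec (lo i n) (f n)) as [h | h]; [exact h|]. destruct q. eauto.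
    + intros i j Hij. destruct (Hlo i j Hij) as [N HN]. exists N. intros n Hn.
      specialize (HN n Hn). lia.
    + exists Y, f. split; [exact HY|]. split; [now apply subq_star_incl|]. split.
      * intros a. destruct (Hf a) as [N HN]. exists N. auto.
      * intros i. apply (subq_star_trans _ _ _ (H i)), subq_star_incl. intros n. lia.
Qed.

(* P : a type of cardinality p; the hypothesis is p < t.
   Conclusion: λ = p (the regular cardinal (W2,R2) with |W2| = p) and some
   regular κ = (W1,R1) with ℵ1 ≤ κ < λ admit a (κ,λ)-peculiar cut. *)
Theorem theorem2p11 (P : Type) (HP : is_p P) (Hpt : p_lt_t P) :
  exists (W1 : Type) (R1 : W1 -> W1 -> Prop)
         (W2 : Type) (R2 : W2 -> W2 -> Prop)
         (lo : W1 -> nat -> nat) (up : W2 -> nat -> nat),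
    eq_card W2 P /\
    is_regular_cardinal W1 R1 /\
    ~ le_card W1 nat /\
    lt_card W1 W2 /\
    peculiar_cut W1 R1 W2 R2 lo up.
Proof.
  destruct (cardinal_order P) as [R [HR Hcard]].
  destruct (positive_chain P R HP Hpt HR Hcard)
    as [K [RK [A [B [Hreg [HK [HPK [Hpos [Hdec Hno]]]]]]]]].
  pose proof (list_le_card P (p_infinite P HP)) as HJ.
  destruct (chain_gap P K RK (list P) A B) as [Y0 [f [h [Hgap Hf]]]]; auto.
  destruct (strict_gap P K RK (list P) Y0 f h) as [lo [upl [Hgap' Hlo]]]; auto.
  { apply Hreg. }
  (* The finite intersections were indexed by lists; a surjection from [P] gives the upper family an
     index of order type [R]. *)
  destruct (le_card_surj HJ []) as [enum Henum].
  destruct (increasing_gap P R K RK Y0 lo (fun a => upl (enum a)))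
    as [Y1 [up [HY10 [Hgap1 [Hup Hlt]]]]]; auto.
  { destruct Hgap' as [HY0 [Hle Hnof]]. split; [exact HY0|]. split; [intros i a; apply Hle|].
    intros [Y [g [HY [HYY0 [Hupg Hlog]]]]]. apply Hnof. exists Y, g. repeat split; auto.
    intros l. destruct (Henum l) as [a <-]. apply Hupg. }
  (* The growth function 0 asks only for strictly increasing points of [Y1]; reindexing by them
     turns relations almost everywhere on [Y1] into relations almost everywhere. *)
  destruct (sparse_subset Y1 (fun _ => 0)) as [e [He1 He2]]; [apply Hgap1|].
  assert (He : forall k, e k < e (S k)) by apply He2.
  pose proof (reindex_gap Y1 lo up e He He1 Hgap1) as Hgap2.
  exists K, RK, P, R, (fun i k => lo i (e k)), (fun a k => up a (e k)).
  split; [exists (fun x => x), (fun x => x); auto|]. split; [exact Hreg|].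
  split; [|split; [exact (conj HK HPK)|]].
  - destruct Hreg as [[_ [[k _] _]] _].
    exact (gap_uncountable P K _ _ Hpt (k 0) Hgap2).
  - apply gap_peculiar; auto.
    + intros i j Hij. apply (reindex_subq_star e Y1 (fun n => lo j n < lo i n)); auto.
      exact (subq_star_trans _ _ _ HY10 (Hlo i j Hij)).
    + intros a b Hab. exact (reindex_subq_star e Y1 (fun n => up a n < up b n) He He1 (Hup a b Hab)).
    + intros i a. exact (reindex_subq_star e Y1 (fun n => up a n < lo i n) He He1 (Hlt i a)).
Qed.
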